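(* There is a deterministic algorithm that, given an unweighted directed graph $G=(V,E)$ with $n$ vertices subject to edge insertions, a vertex $s\in V$, and $\varepsilon>0$, maintains for every vertex $v$ an estimate $\hat{d}(v)$ such that after every update $d(s,v)\leq \hat{d}(v)\leq (1+\varepsilon)\,d(s,v)$, in total time $O(n^{2+2/3}/\varepsilon)$.
   Context: $d(s,v)$ is the shortest-path distance (number of edges) from $s$ to $v$ in the current graph. Total time is over the whole update sequence.
   Formalization: The total time is bounded by O(n^{2+2/3}/min(1,ε)) instead of O(n^{2+2/3}/ε), since for ε far above n^{2+2/3} the literal bound is below one step; for ε ≤ 1 it is the stated bound. Each update inserts an edge not yet present. *)

(* Defs.v *)
From HB Require Import structures.
From mathcomp Require Export all_boot all_order all_algebra.
From mathcomp Require Export classical_sets reals ereal exp.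

Set Implicit Arguments.
Unset Strict Implicit.
Unset Printing Implicit Defensive.

Import Order.TTheory GRing.Theory Num.Theory.

(* Unweighted directed graphs on the vertex set 'I_n are given by their edge
   sets; d(s, v) is +oo when there is no path from s to v. *)

Definition edge_rel (n : nat) (E : {set 'I_n * 'I_n}) : rel 'I_n :=
  fun x y => (x, y) \in E.

Definition dist (R : realType) (n : nat) (E : {set 'I_n * 'I_n})
    (s v : 'I_n) : \bar R :=
  ereal_inf (image [set p | path (edge_rel E) s p /\ last s p = v]%classic
                   (fun p : seq 'I_n => (((size p)%:R : R)%:E)%E)).

(* The graph after performing the insertions us on the graph E. *)
Definition insert_all (n : nat) (E : {set 'I_n * 'I_n})
    (us : seq ('I_n * 'I_n)) : {set 'I_n * 'I_n} :=
  E :|: [set u in us].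

(* Every update inserts an edge absent from the current graph. *)
Definition valid_insertions (n : nat) (E : {set 'I_n * 'I_n})
    (us : seq ('I_n * 'I_n)) : bool :=
  uniq us && all (fun u => u \notin E) us.

(* Machine model: a deterministic word RAM with w-bit words, programmed in a
   WHILE language. A fixed program uses finitely many registers and finitely
   many arrays, both numbered by constants of the program; array cells are
   addressed by words. The real number eps is an input that the program can
   only access by unit-cost tests  a * eps <= b  for words a and b. *)

Inductive binop := OpAdd | OpSub | OpMul | OpDiv | OpMod | OpEq | OpLt.

Inductive expr :=
  | Const of nat
  | Reg of nat
  | Read of nat & expr
  | Bin of binop & expr & expr
  | EpsLe of expr & expr.

Inductive cmd :=
  | Skip
  | Assign of nat & expr
  | Write of nat & expr & expr
  | Seq of cmd & cmd
  | If of expr & cmd & cmd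
  | While of expr & cmd.

Record state := State {
  regs : nat -> nat;
  arrays : nat -> nat -> nat }.

Definition set_reg (x k : nat) (st : state) : state :=
  State (fun y => if y == x then k else regs st y) (arrays st).

Definition set_cell (a i k : nat) (st : state) : state :=
  State (regs st)
    (fun b j => if (b == a) && (j == i) then k else arrays st b j).

(* Subtraction is truncated at 0; tests return 0 or 1. *)
Definition eval_binop (o : binop) (a b : nat) : nat :=
  match o with
  | OpAdd => a + b
  | OpSub => a - b
  | OpMul => a * b
  | OpDiv => a %/ b
  | OpMod => a %% b
  | OpEq => a == b
  | OpLt => a < b
  end.

Fixpoint eval (R : realType) (w : nat) (eps : R) (st : state) (e : expr)
    : nat :=
  match e with
  | Const k => k %% 2 ^ w
  | Reg x => regs st x
  | Read a i => arrays st a (eval w eps st i)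
  | Bin o e1 e2 =>
      eval_binop o (eval w eps st e1) (eval w eps st e2) %% 2 ^ w
  | EpsLe e1 e2 =>
      ((eval w eps st e1)%:R * eps <= (eval w eps st e2)%:R)%R
  end.

Fixpoint ecost (e : expr) : nat :=
  match e with
  | Const _ | Reg _ => 1
  | Read _ i => (ecost i).+1
  | Bin _ e1 e2 | EpsLe e1 e2 => (ecost e1 + ecost e2).+1
  end.

(* exec w eps c st t st' : from state st, c halts in state st' after time t. *)
Inductive exec (R : realType) (w : nat) (eps : R)
    : cmd -> state -> nat -> state -> Prop :=
  | ExecSkip st : exec w eps Skip st 1 st
  | ExecAssign x e st :
      exec w eps (Assign x e) st (ecost e).+1
           (set_reg x (eval w eps st e) st)
  | ExecWrite a i e st :
      exec w eps (Write a i e) st (ecost i + ecost e).+1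
           (set_cell a (eval w eps st i) (eval w eps st e) st)
  | ExecSeq c1 c2 st st1 st2 t1 t2 :
      exec w eps c1 st t1 st1 -> exec w eps c2 st1 t2 st2 ->
      exec w eps (Seq c1 c2) st (t1 + t2) st2
  | ExecIf e c1 c2 st st1 t :
      exec w eps (if eval w eps st e != 0 then c1 else c2) st t st1 ->
      exec w eps (If e c1 c2) st (ecost e + t).+1 st1
  | ExecWhileEnd e c st :
      eval w eps st e = 0 ->
      exec w eps (While e c) st (ecost e).+1 st
  | ExecWhileStep e c st st1 st2 t1 t2 :
      eval w eps st e <> 0 ->
      exec w eps c st t1 st1 -> exec w eps (While e c) st1 t2 st2 ->
      exec w eps (While e c) st (ecost e + t1 + t2).+1 st2.

Lemma exec_det (R : realType) (w : nat) (eps : R) c st t1 st1 t2 st2 :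
  exec w eps c st t1 st1 -> exec w eps c st t2 st2 -> t1 = t2 /\ st1 = st2.
Proof.
move=> H1; elim: H1 t2 st2 => {c st t1 st1} *;
  match goal with H : exec _ _ _ _ _ _ |- _ => inversion H; subst end => //;
  repeat match goal with
  | IH : forall t st, exec _ _ ?c ?a t st -> _, H : exec _ _ ?c ?a _ _ |- _ =>
      have [? ?] := IH _ _ H; clear H; subst
  end; by [].
Qed.

(* An incremental algorithm is a pair of programs sharing their memory: alg_init
   preprocesses the initial graph, alg_update processes one insertion. *)
Record algorithm := Algorithm {
  alg_init : cmd;
  alg_update : cmd }.

(* Initially register 0 holds n, register 1 holds s and array 0 holds the
   row-major adjacency matrix of the initial graph; the rest is 0. *)
Definition init_state (n : nat) (E : {set 'I_n * 'I_n}) (s : 'I_n) : state :=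
  State
    (fun x => if x == 0 then n else if x == 1 then nat_of_ord s else 0)
    (fun a i =>
       if a == 0 then nat_of_bool [exists p in E, i == p.1 * n + p.2] else 0).

(* The insertion of (x, y) is announced by storing x in register 2 and y in
   register 3. *)
Definition announce (n : nat) (u : 'I_n * 'I_n) (st : state) : state :=
  set_reg 3 u.2 (set_reg 2 u.1 st).

(* run A w eps E s us t st : on input (E, s, eps), A has processed the updates
   us, one at a time and in this order, in total time t (preprocessing
   included), and its state is now st. *)
Inductive run (R : realType) (A : algorithm) (w : nat) (eps : R) (n : nat)
    (E : {set 'I_n * 'I_n}) (s : 'I_n)
    : seq ('I_n * 'I_n) -> nat -> state -> Prop :=
  | RunInit t st :
      exec w eps (alg_init A) (init_state E s) t st ->
      run A w eps E s [::] t st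
  | RunUpdate us u t t' st st' :
      run A w eps E s us t st ->
      exec w eps (alg_update A) (announce u st) t' st' ->
      run A w eps E s (rcons us u) (t + t') st'.

(* The estimate of v is cell v of array 1, where 0 encodes +oo and k + 1
   encodes k. *)
Definition estimate (R : realType) (n : nat) (st : state) (v : 'I_n) : \bar R :=
  match arrays st 1 v with
  | 0 => +oo%E
  | k.+1 => ((k%:R : R)%:E)%E
  end.

(* Main.v *)
(* Let delta be the least integer with delta^3 >= n. Besides the estimates, which
   only decrease, the algorithm keeps the vertices in buckets of delta consecutive
   levels. A vertex whose estimate enters a new bucket relaxes all its out-edges;
   a decrease inside a bucket is propagated only to the vertices of that bucket,
   and only if the bucket holds fewer than delta^2 vertices (is light) or the
   estimate is at most a threshold D of order delta^2 / eps. Otherwise the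
   relaxation is postponed until the bucket becomes light.

   Along a path, an edge leaving a vertex without postponed relaxation raises the
   estimate by at most 1, and one leaving a heavy bucket raises it at most to the
   end of that bucket. Hence the number of levels in light buckets below the
   estimate of a vertex is at most its distance. At most delta buckets are heavy,
   so the estimate exceeds the distance by at most delta^2, and it is exact up to
   distance D; together this is a (1 + eps)-approximation.

   Every vertex decreases O(n) times at cost delta^2, changes its bucket
   O(n / delta) times at cost n, and decreases below D at most D times at cost n.
   The total n^2 (delta^2 + D) is O(n^(2 + 2/3) / eps). *)

Require Import Defs.
From mathcomp Require Import zify ring lra.

Set Implicit Arguments.
Unset Strict Implicit.
Unset Printing Implicit Defensive.

Import Order.TTheory GRing.Theory Num.Theory.

(** * Levels of light buckets *)

Section LightLevels.
Variables (n delta : nat) (bucket : 'I_n -> nat).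
Hypothesis delta_gt0 : 0 < delta.

Definition bucket_size (b : nat) : nat := #|[set v | bucket v == b]|.

Definition light (y : nat) : bool := bucket_size (y %/ delta) < delta * delta.

(** A rank of levels that ignores heavy buckets; this rank, not the level itself, is compared with
    the distance. *)
Definition light_below (x : nat) : nat := count light (iota 0 x).

Lemma light_below_cat x y : x <= y ->
  light_below y = light_below x + count light (iota x (y - x)).
Proof. by move=> le_xy; rewrite /light_below -{1}(subnKC le_xy) iotaD count_cat. Qed.

Lemma light_below_mono x y : x <= y -> light_below x <= light_below y.
Proof. by move=> /light_below_cat ->; apply: leq_addr. Qed.

Lemma light_below_succ x y : y <= x + 1 -> light_below y <= light_below x + 1.
Proof.
move=> le_yx; apply: leq_trans (light_below_mono le_yx) _.
rewrite (@light_below_cat x) ?leq_addr // leq_add2l.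
by apply: leq_trans (count_size _ _) _; rewrite size_iota addKn.
Qed.

(** All levels from [x] to the end of its bucket share the same heavy bucket, so none of them is
    counted. *)
Lemma light_below_heavy x y : ~~ light x -> y <= delta * (x %/ delta).+1 ->
  light_below y <= light_below x.
Proof.
move=> heavy_x; set top := _ * _ => le_y.
have x_top : x <= top by rewrite /top mulnC ltnW // ltn_ceil.
apply: leq_trans (light_below_mono le_y) _.
rewrite (light_below_cat x_top) -[X in _ <= X]addn0 leq_add2l leqn0.
rewrite -(@eq_in_count _ xpred0) ?count_pred0 // => z; rewrite mem_iota => /andP[le_xz lt_z].
rewrite /light; have -> : z %/ delta = x %/ delta; last by apply/esym/negbTE.
apply/eqP; rewrite eqn_leq [X in _ && X]leq_div2r // andbT -ltnS ltn_divLR // mulnC.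
by apply: leq_trans lt_z _; rewrite subnKC.
Qed.

Lemma count_bucket_levels b x :
  count (fun y => y %/ delta == b) (iota 0 x) <= delta.
Proof.
rewrite -size_filter -[X in _ <= X](size_iota (b * delta)); apply: uniq_leq_size.
  by rewrite filter_uniq // iota_uniq.
move=> y; rewrite mem_filter => /andP[/eqP <- _].
by rewrite mem_iota leq_trunc_div /= addnC -mulSn ltn_ceil.
Qed.

Hypothesis delta_cube : n <= delta * delta * delta.

(** Double counting of the pairs of a level below [x] and a vertex in its bucket: a heavy level
    meets at least [delta * delta] vertices, a vertex at most [delta] levels. So [delta * delta]
    times the number of heavy levels is at most [n * delta], which [delta_cube] bounds by the fourth
    power of [delta]. *)
Lemma light_below_gap x : x <= light_below x + delta * delta.
Proof.
rewrite -[X in X <= _](size_iota 0) -(count_predC light) leq_add2l.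
have k_gt0 : 0 < delta * delta by rewrite muln_gt0 delta_gt0.
rewrite -(leq_pmul2l k_gt0).
apply: (@leq_trans (\sum_(y <- iota 0 x) bucket_size (y %/ delta))).
  rewrite -sum1_count big_distrr /= big_mkcond /=; apply: leq_sum => y _.
  by rewrite /light; case: ltnP => //=; rewrite muln1.
under eq_bigr => y _ do rewrite /bucket_size -sum1dep_card big_mkcond /=.
rewrite exchange_big /=; apply: (@leq_trans (\sum_(v < n) delta)).
  apply: leq_sum => v _; rewrite -big_mkcond /= sum1_count.
  by under eq_count => y do rewrite eq_sym; apply: count_bucket_levels.
rewrite sum_nat_const card_ord; apply: leq_trans (leq_mul delta_cube (leqnn _)) _.
by rewrite !mulnA.
Qed.

End LightLevels.

(** * Cost-aware weakest preconditions *)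

Section Wp.
Variables (R : realType) (w : nat) (eps : R).

(** Total correctness: halting is part of the claim, and the postcondition also receives the running
    time. *)
Definition wp (c : cmd) (Q : nat -> state -> Prop) (st : state) : Prop :=
  exists t st', exec w eps c st t st' /\ Q t st'.

Fixpoint exact_eval (st : state) (e : expr) : nat :=
  match e with
  | Const k => k
  | Reg x => regs st x
  | Read a i => arrays st a (exact_eval st i)
  | Bin o e1 e2 => eval_binop o (exact_eval st e1) (exact_eval st e2)
  | EpsLe e1 e2 =>
      ((exact_eval st e1)%:R * eps <= (exact_eval st e2)%:R)%R
  end.

(** Bounds that make the reduction modulo [2 ^ w] harmless. Difference, quotient and remainder never
    exceed the first operand, so bounding that one suffices. *)
Fixpoint no_overflow (st : state) (e : expr) : Prop :=
  match e with
  | Const k => k < 2 ^ w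
  | Reg _ => True
  | Read _ i => no_overflow st i
  | Bin o e1 e2 =>
      [/\ no_overflow st e1, no_overflow st e2 &
      match o with
      | OpAdd => exact_eval st e1 + exact_eval st e2 < 2 ^ w
      | OpMul => exact_eval st e1 * exact_eval st e2 < 2 ^ w
      | OpSub | OpDiv | OpMod => exact_eval st e1 < 2 ^ w
      | OpEq | OpLt => 1 < 2 ^ w
      end]
  | EpsLe e1 e2 => no_overflow st e1 /\ no_overflow st e2
  end.

Lemma eval_exact st e : no_overflow st e -> eval w eps st e = exact_eval st e.
Proof.
elim: e => //= [k|a i IH|o e1 IH1 e2 IH2 [h1 h2 ho]|e1 IH1 e2 IH2 [h1 h2]].
- exact: modn_small.
- by move=> /IH ->.
- rewrite IH1 // IH2 // modn_small //.
  case: o ho => //= h.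
  + exact: leq_ltn_trans (leq_subr _ _) h.
  + exact: leq_ltn_trans (leq_div _ _) h.
  + exact: leq_ltn_trans (leq_mod _ _) h.
  + by apply: leq_ltn_trans h; case: eqP.
  + by apply: leq_ltn_trans h; case: ltnP.
- by rewrite IH1 // IH2.
Qed.

Lemma wp_mono c (P Q : nat -> state -> Prop) st :
  (forall t st', P t st' -> Q t st') -> wp c P st -> wp c Q st.
Proof. by move=> h [t [st' [ex p]]]; exists t, st'; split => //; apply: h. Qed.

Lemma wp_skip (Q : nat -> state -> Prop) st : Q 1 st -> wp Skip Q st.
Proof. by exists 1, st; split => //; apply: ExecSkip. Qed.

Lemma wp_assign x e (Q : nat -> state -> Prop) st :
  no_overflow st e ->
  Q (ecost e).+1 (set_reg x (exact_eval st e) st) -> wp (Assign x e) Q st.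
Proof.
move=> /eval_exact <- q; eexists; eexists; split; last exact: q.
exact: ExecAssign.
Qed.

Lemma wp_write a i e (Q : nat -> state -> Prop) st :
  no_overflow st i -> no_overflow st e ->
  Q (ecost i + ecost e).+1 (set_cell a (exact_eval st i) (exact_eval st e) st) ->
  wp (Write a i e) Q st.
Proof.
move=> /eval_exact <- /eval_exact <- q; eexists; eexists; split; last exact: q.
exact: ExecWrite.
Qed.

Lemma wp_seq c1 c2 (Q : nat -> state -> Prop) st :
  wp c1 (fun t1 st1 => wp c2 (fun t2 st2 => Q (t1 + t2) st2) st1) st ->
  wp (Seq c1 c2) Q st.
Proof.
move=> [t1 [st1 [ex1 [t2 [st2 [ex2 q]]]]]]; exists (t1 + t2), st2.
by split => //; apply: ExecSeq ex1 ex2.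
Qed.

Lemma wp_if e c1 c2 (Q : nat -> state -> Prop) st :
  no_overflow st e ->
  (exact_eval st e != 0 -> wp c1 (fun t st' => Q (ecost e + t).+1 st') st) ->
  (exact_eval st e = 0 -> wp c2 (fun t st' => Q (ecost e + t).+1 st') st) ->
  wp (If e c1 c2) Q st.
Proof.
move=> ok h1 h2.
have [t [st' [ex q]]] :
    wp (if eval w eps st e != 0 then c1 else c2)
       (fun t st' => Q (ecost e + t).+1 st') st.
  rewrite eval_exact //; case: ifP => [/h1 //|/negbFE/eqP]; exact: h2.
by exists (ecost e + t).+1, st'; split => //; apply: ExecIf.
Qed.

(** The potential pays for every iteration. An iteration takes at least one unit of time, so [pot]
    is also the termination measure; only the last test of the guard is paid separately. *)
Lemma wp_while e c (Inv : state -> Prop) (pot : state -> nat) st :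
  (forall st, Inv st -> no_overflow st e) ->
  (forall st, Inv st -> exact_eval st e != 0 ->
     wp c (fun t st' => Inv st' /\ (ecost e + t).+1 + pot st' <= pot st) st) ->
  Inv st ->
  wp (While e c)
     (fun t st' => [/\ Inv st', exact_eval st' e = 0 &
                       t + pot st' <= pot st + (ecost e).+1]) st.
Proof.
move=> ok body; have [m] := ubnP (pot st); elim: m st => // m IH st lt_m inv.
have [e0|e1] := eqVneq (exact_eval st e) 0.
  exists (ecost e).+1, st; split; last by rewrite addnC.
  by apply: ExecWhileEnd; rewrite eval_exact //; apply: ok.
have [t [st1 [ex1 [inv1 le1]]]] := body st inv e1.
have [|t2 [st2 [ex2 [inv2 e2 le2]]]] := IH st1 _ inv1; first by lia.
exists (ecost e + t + t2).+1, st2; split; last by split => //; lia.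
by apply: ExecWhileStep ex1 ex2; rewrite eval_exact; [apply/eqP|apply: ok].
Qed.

Definition same_except (r : nat) (st st' : state) : Prop :=
  (forall x, x != r -> regs st' x = regs st x) /\ arrays st' = arrays st.

Lemma wp_search r g (P : pred nat) m st :
  P m -> (forall i, i < m -> ~~ P i) -> m + 1 < 2 ^ w -> regs st r = 0 ->
  (forall st', same_except r st st' -> regs st' r <= m ->
     no_overflow st' g /\ (exact_eval st' g != 0) = ~~ P (regs st' r)) ->
  wp (While g (Assign r (Bin OpAdd (Reg r) (Const 1))))
    (fun t st' => [/\ same_except r st st', regs st' r = m
       & t <= (ecost g + 5) * m + (ecost g).+1]) st.
Proof.
move=> Pm Pmin ltm r0 guard.
pose J st' := same_except r st st' /\ regs st' r <= m.
apply: wp_mono; last first.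
  apply: (@wp_while g _ J (fun st' => (ecost g + 5) * (m - regs st' r))).
  - by move=> st' [h1 h2]; have [] := guard st' h1 h2.
  - move=> st' [[h1 h1'] h2].
    have [_ ->] := guard st' (conj h1 h1') h2 => nP.
    have lt_m : regs st' r < m by rewrite ltn_neqAle h2 andbT; apply: contraNneq nP => ->.
    apply: wp_assign => /=; first by repeat (split => //); lia.
    split; last by rewrite eqxx; nia.
    by split; [split => // x /= /negbTE nx; rewrite nx h1 // nx|rewrite /= eqxx; lia].
  - by split; rewrite ?r0.
move=> t st' [[h1 h2] e0 cost]; have [_] := guard st' h1 h2.
rewrite e0 eqxx => /esym/negbFE PP; split => //.
  apply/eqP; rewrite eqn_leq h2 /= leqNgt; apply/negP => /Pmin; by rewrite PP.
by move: cost; rewrite r0 subn0; lia.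
Qed.

End Wp.

(** * The program *)

(* Registers: 0 = n, 1 = s, 2 and 3 = tail and head of the edge being relaxed,
   4 = bucket width, 5 = exactness threshold, 6 = value standing for an infinite
   distance, 7 = flag "the bucket lists are stale", 8 = height of the stack,
   9 = loop counter, 10 = loop bound, 11 = flag "scan all vertices".
   Arrays: 0 = adjacency matrix, 1 = estimates, 2 = flag "the estimate of the
   vertex has decreased since its last scan", 3 = flag "its bucket has changed
   since its last scan", 4 = sizes of the bucket lists, 5 = the bucket lists
   (one row of length n per bucket), 6 = stack of vertices to be examined. *)

(* In array 1, infinity is 0 and the finite value d is d + 1; the remainder
   turns 0 into the content of register 6 and d + 1 into d. *)
Definition dist_expr (v : expr) : expr :=
  Bin OpMod (Bin OpAdd (Read 1 v) (Reg 6)) (Bin OpAdd (Reg 6) (Const 1)).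

Definition succ_expr (e : expr) : expr := Bin OpAdd e (Const 1).
Definition pred_expr (e : expr) : expr := Bin OpSub e (Const 1).
Definition bucket_expr (e : expr) : expr := Bin OpDiv e (Reg 4).

(** [moved] refers to the buckets that govern scanning, [moved'] to the rows of the bucket lists,
    which are shifted by one level. The estimate is written last because both tests read the old
    one. *)
Definition relax_cmd : cmd :=
  let new := succ_expr (dist_expr (Reg 2)) in
  let old := dist_expr (Reg 3) in
  let moved := Bin OpLt (bucket_expr new) (bucket_expr old) in
  let moved' := Bin OpLt (bucket_expr (pred_expr new))
                         (bucket_expr (pred_expr old)) in
  If (Bin OpMul (Read 0 (Bin OpAdd (Bin OpMul (Reg 2) (Reg 0)) (Reg 3)))
                (Bin OpLt new old))
     (Seq (Write 3 (Reg 3)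
             (Bin OpLt (Const 0) (Bin OpAdd (Read 3 (Reg 3)) moved)))
     (Seq (Assign 7 (Bin OpLt (Const 0)
             (Bin OpAdd (Reg 7) (Bin OpAdd moved moved'))))
     (Seq (Write 2 (Reg 3) (Const 1))
     (Seq (Write 6 (Reg 8) (Reg 3))
     (Seq (Assign 8 (succ_expr (Reg 8)))
          (Write 1 (Reg 3) (succ_expr new)))))))
     Skip.

Definition scan_cmd : cmd :=
  let row := bucket_expr (dist_expr (Reg 2)) in
  Seq (Assign 11 (Read 3 (Reg 2)))
  (Seq (If (Reg 11) (Assign 10 (Reg 0)) (Assign 10 (Read 4 row)))
  (Seq (Write 2 (Reg 2) (Const 0))
  (Seq (Write 3 (Reg 2) (Const 0))
  (Seq (Assign 9 (Const 0))
       (While (Bin OpLt (Reg 9) (Reg 10))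
          (Seq (If (Reg 11) (Assign 3 (Reg 9))
                 (Assign 3 (Read 5 (Bin OpAdd (Bin OpMul row (Reg 0)) (Reg 9)))))
          (Seq relax_cmd
               (Assign 9 (succ_expr (Reg 9)))))))))).

(** A rebuild can reveal that a heavy bucket has become light, so every vertex is put on the stack
    to be examined again. *)
Definition refresh_cmd : cmd :=
  let row := bucket_expr (pred_expr (dist_expr (Reg 9))) in
  Seq (Assign 9 (Const 0))
  (Seq (While (Bin OpLt (Reg 9) (succ_expr (Reg 6)))
          (Seq (Write 4 (Reg 9) (Const 0))
               (Assign 9 (succ_expr (Reg 9)))))
  (Seq (Assign 9 (Const 0))
  (Seq (While (Bin OpLt (Reg 9) (Reg 0))
          (Seq (Assign 10 row)
          (Seq (Write 5 (Bin OpAdd (Bin OpMul (Reg 10) (Reg 0)) (Read 4 (Reg 10)))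
                        (Reg 9))
          (Seq (Write 4 (Reg 10) (succ_expr (Read 4 (Reg 10))))
          (Seq (Write 6 (Reg 9) (Reg 9))
               (Assign 9 (succ_expr (Reg 9))))))))
  (Seq (Assign 8 (Reg 0))
       (Assign 7 (Const 0)))))).

(** Products stand for conjunctions and sums for disjunctions. The first factor discards stack
    entries of vertices whose flag an earlier scan has cleared. *)
Definition eligible_expr : expr :=
  Bin OpMul (Read 2 (Reg 2))
    (Bin OpAdd (Read 3 (Reg 2))
    (Bin OpAdd (Bin OpLt (dist_expr (Reg 2)) (succ_expr (Reg 5)))
               (Bin OpLt (Read 4 (bucket_expr (dist_expr (Reg 2))))
                         (Bin OpMul (Reg 4) (Reg 4))))).

Definition main_cmd : cmd :=
  While (Bin OpAdd (Reg 7) (Reg 8))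
    (If (Reg 7) refresh_cmd
       (Seq (Assign 8 (pred_expr (Reg 8)))
       (Seq (Assign 2 (Read 6 (Reg 8)))
            (If eligible_expr scan_cmd Skip)))).

Definition incremental_sssp : algorithm :=
  Algorithm
    (Seq (While (Bin OpLt (Bin OpMul (Bin OpMul (Reg 4) (Reg 4)) (Reg 4)) (Reg 0))
            (Assign 4 (succ_expr (Reg 4))))
    (Seq (Assign 6 (Bin OpAdd (Reg 0) (Bin OpMul (Reg 4) (Reg 4))))
    (Seq (While (Bin OpMul (Bin OpLt (Reg 5) (Reg 6))
                           (EpsLe (Reg 5) (Bin OpMul (Reg 4) (Reg 4))))
            (Assign 5 (succ_expr (Reg 5))))
    (Seq (Write 1 (Reg 1) (Const 1))
    (Seq (Write 2 (Reg 1) (Const 1))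
    (Seq (Write 3 (Reg 1) (Const 1))
    (Seq (Assign 7 (Const 1))
         main_cmd)))))))
    (Seq (Write 0 (Bin OpAdd (Bin OpMul (Reg 2) (Reg 0)) (Reg 3)) (Const 1))
    (Seq relax_cmd
         main_cmd)).

Lemma sum_update (n : nat) (y : 'I_n) (f g : 'I_n -> nat) :
  (forall v, v != y -> f v = g v) ->
  \sum_v f v + g y = \sum_v g v + f y.
Proof.
move=> fg; rewrite (bigD1 y) //= [in RHS](bigD1 y) //= (eq_bigr g) //; lia.
Qed.

(** * The invariant *)

Section Invariant.
Variables (n : nat) (s : 'I_n) (delta D U : nat).

(* Larger than the estimate of every reachable vertex, since estimates exceed
   distances by at most delta * delta. *)
Definition inf_value := n + delta * delta.

Definition cur_dist (st : state) (v : nat) : nat :=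
  (arrays st 1 v + inf_value) %% (inf_value + 1).

(* Amortization: a decrease of an estimate releases [drop_weight], which pays for
   the later scan of the vertex ([vertex_pot] with its flags set), for rebuilding
   the bucket lists (register 7) and for its stack entry (register 8). One unit of
   potential pays for 200 units of time. *)
Definition drop_weight (d : nat) : nat :=
  delta * delta * d + n * minn d D.+1 +
  inf_value.+1 * (d %/ delta + (d - 1) %/ delta).

Definition vertex_pot (d dirty full : nat) : nat :=
  2 * (dirty * (delta * delta + n * (d <= D)) + full * n) + 6 * drop_weight d.

Definition potential (st : state) : nat :=
  \sum_(v < n) vertex_pot (cur_dist st v) (arrays st 2 v) (arrays st 3 v)
  + 4 * (inf_value.+1 * regs st 7) + regs st 8.

Definition walk (E : {set 'I_n * 'I_n}) (v : 'I_n) (d : nat) : Prop :=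
  exists p, [/\ path (edge_rel E) s p, last s p = v & size p <= d].

(** Row [b] holds the levels [b * delta + 1] to [(b + 1) * delta], and row 0 also level 0. With this
    shift it contains every successor that a vertex [u] of bucket [b] with clear flag in array 3 can
    still lower: such a successor lies above level [d(u) + 1] and, by [inv_bucket], not above
    [(b + 1) * delta]. *)
Definition lists_ok (st : state) : Prop :=
  forall b, b <= inf_value ->
  [/\ arrays st 4 b = #|[set v : 'I_n | (cur_dist st v - 1) %/ delta == b]|,
      forall i, i < arrays st 4 b -> arrays st 5 (b * n + i) < n
    & forall v : 'I_n, (cur_dist st v - 1) %/ delta = b ->
        exists2 i, i < arrays st 4 b & arrays st 5 (b * n + i) = v].

Definition scannable (st : state) (u : nat) : bool :=
  [|| arrays st 3 u != 0, cur_dist st u <= D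
    | arrays st 4 (cur_dist st u %/ delta) < delta * delta].

(* The edges outside F are those whose relaxation is still pending. *)
Record invariant (E : {set 'I_n * 'I_n}) (F : rel 'I_n) (st : state) : Prop := Inv {
  inv_n : regs st 0 = n;
  inv_delta : regs st 4 = delta;
  inv_D : regs st 5 = D;
  inv_infty : regs st 6 = inf_value;
  inv_adj : forall u v : 'I_n, arrays st 0 (u * n + v) = ((u, v) \in E);
  inv_est : forall v : 'I_n, arrays st 1 v <= inf_value;
  inv_source : arrays st 1 s = 1;
  inv_dirty : forall v : 'I_n, arrays st 2 v <= 1;
  inv_full : forall v : 'I_n, arrays st 3 v <= 1;
  inv_flag : regs st 7 <= 1;
  inv_sound : forall v : 'I_n, arrays st 1 v != 0 -> walk E v (cur_dist st v);
  inv_stack : forall j, j < regs st 8 -> arrays st 6 j < n;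
  inv_pot : potential st <= U;
  (* A scan of all out-edges leaves each successor at most one level higher, hence not beyond the
     end of the bucket; this persists while [u] stays in its bucket. *)
  inv_bucket : forall u v : 'I_n, (u, v) \in E -> F u v -> arrays st 3 u = 0 ->
    cur_dist st v <= delta * (cur_dist st u %/ delta).+1;
  inv_exact : forall u v : 'I_n, (u, v) \in E -> F u v -> arrays st 2 u = 0 ->
    cur_dist st v <= (cur_dist st u).+1;
  inv_lists : regs st 7 = 0 -> lists_ok st;
  inv_queue : regs st 7 = 0 -> forall u : 'I_n, arrays st 2 u = 1 ->
    scannable st u -> exists2 j, j < regs st 8 & arrays st 6 j = u }.

Lemma dh_le st v : cur_dist st v <= inf_value.
Proof. by rewrite -ltnS -[inf_value.+1]addn1 ltn_pmod ?addn1. Qed.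

Lemma dh_finite st v d : d <= inf_value -> arrays st 1 v = d + 1 -> cur_dist st v = d.
Proof.
by move=> le_d e; rewrite /cur_dist e -addnA [1 + _]addnC modnDr modn_small // addn1.
Qed.

Lemma dh_reached st v : 0 < arrays st 1 v <= inf_value -> arrays st 1 v = (cur_dist st v).+1.
Proof.
move=> h; rewrite (@dh_finite st v (arrays st 1 v - 1)); lia.
Qed.

Lemma dh_unreached st v : arrays st 1 v = 0 -> cur_dist st v = inf_value.
Proof. by move=> e; rewrite /cur_dist e modn_small ?addn1. Qed.

Hypothesis delta_gt0 : 0 < delta.

Lemma bucket_le d : d <= inf_value -> d %/ delta <= inf_value.
Proof. exact: leq_trans (leq_div _ _). Qed.

(** Each term of the weight covers one expense: the linear term loses at least [delta * delta]; the
    minimum, capped at [D.+1], falls whenever the new level is at most [D], even if the old one was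
    above; the quotients fall when a bucket or row is left. *)
Lemma drop_weight_drop d' d : d' < d ->
  delta * delta + n * (d' <= D) +
    inf_value.+1 * ((d' %/ delta < d %/ delta) + ((d' - 1) %/ delta < (d - 1) %/ delta))
    + drop_weight d' <= drop_weight d.
Proof.
move=> lt_d; rewrite /drop_weight.
have h1 : delta * delta + delta * delta * d' <= delta * delta * d.
  by rewrite -mulnS leq_mul.
have h2 : n * (d' <= D) + n * minn d' D.+1 <= n * minn d D.+1.
  by rewrite -mulnDr leq_mul //; lia.
have h3 : d' %/ delta <= d %/ delta by apply: leq_div2r; apply: ltnW.
have h4 : (d' - 1) %/ delta <= (d - 1) %/ delta.
  by apply: leq_div2r; apply: leq_sub2r; apply: ltnW.
move: (d' %/ delta) (d %/ delta) ((d' - 1) %/ delta) ((d - 1) %/ delta) h3 h4.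
move=> a b a' b' h3 h4.
have h5 : inf_value.+1 * ((a < b) + (a' < b')) + inf_value.+1 * (a + a') <=
    inf_value.+1 * (b + b').
  by rewrite -mulnDr leq_mul2l; apply/orP; right; lia.
move: (inf_value.+1 * _) (inf_value.+1 * _) (inf_value.+1 * _) h1 h2 h5 => x y z.
move: (n * _) (n * _) (n * _) (delta * delta * _) (delta * delta * _) => *.
lia.
Qed.

Lemma vertex_pot_drop d' d q f fl (mv mv' : bool) : d' < d ->
  mv = (d' %/ delta < d %/ delta) ->
  mv' = ((d' - 1) %/ delta < (d - 1) %/ delta) ->
  vertex_pot d' 1 (0 < f + mv) + 4 * (inf_value.+1 * (0 < fl + (mv + mv'))) + 1 <=
  vertex_pot d q f + 4 * (inf_value.+1 * fl).
Proof.
move=> /drop_weight_drop h mvE mvE'; rewrite -mvE -mvE' in h.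
have le_n : n <= inf_value by apply: leq_addr.
have k1 : 0 < delta * delta by rewrite muln_gt0 delta_gt0.
have lt0_le m : (0 < m) <= m by case: m.
have h1 : (0 < f + mv) * n <= f * n + inf_value.+1 * mv.
  apply: leq_trans (leq_mul (lt0_le _) (leqnn n)) _.
  by rewrite mulnDl leq_add2l mulnC leq_mul // leqW.
have h2 : inf_value.+1 * (0 < fl + (mv + mv')) <= inf_value.+1 * fl + inf_value.+1 * (mv + mv').
  by rewrite -mulnDr leq_mul.
have h3 : inf_value.+1 * mv <= inf_value.+1 * (mv + mv') by rewrite leq_mul2l leq_addr orbT.
rewrite /vertex_pot {mvE mvE'}.
have h4 : 0 <= q * (delta * delta + n * (d <= D)) by [].
move: (q * _) h4 => q1 _.
set N1 := inf_value.+1 * mv in h1 h3; set N2 := inf_value.+1 * (mv + mv') in h h2 h3.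
set N3 := inf_value.+1 * _ in h2 *; set N4 := inf_value.+1 * fl in h2 *.
set f1 := f * n in h1 *; set f2 := _ * n in h1 *.
set n1 := n * _ in h *; set k := delta * delta in h k1 *.
set x := drop_weight _ in h *; set y := drop_weight _ in h *.
clearbody N1 N2 N3 N4 f1 f2 n1 k x y; clear -h h1 h2 h3 k1; lia.
Qed.

End Invariant.

Ltac gen_bools :=
  repeat match goal with
  | |- context [nat_of_bool ?b] => have := leq_b1 b; move: (nat_of_bool b) => ? ?
  end.

Ltac solve_no_overflow E1 E2 E3 E4 E5 E6 E7 := rewrite /= ?E1 ?E2 ?E3 ?E4 ?E5 ?E7 ?E6;
  repeat (split => //); rewrite -?subn1; gen_bools; nia.

(** * Effect and cost of relaxing one edge *)

Section Execution.
Variables (R : realType) (w : nat) (eps : R).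
Variables (n : nat) (s : 'I_n) (delta D U : nat).

Local Notation infty := (inf_value n delta).
Local Notation dh := (cur_dist n delta).
Local Notation pot := (potential n delta D).
Local Notation inv := (invariant s delta D U).
Local Notation eligible := (scannable n delta D).
Local Notation wp := (wp w eps).

Hypothesis delta_gt0 : 0 < delta.
Hypothesis D_le : D <= infty.
Hypothesis word_size : U + 10 * ((infty + 2) * (n + 2)) < 2 ^ w.

Lemma word_bounds :
  [/\ U + 10 < 2 ^ w, 4 * infty + 10 < 2 ^ w, infty * n + n < 2 ^ w
    & n * n + n < 2 ^ w].
Proof.
have := word_size; have : n <= infty by apply: leq_addr.
move: infty => M; split; nia.
Qed.

Lemma dh_def st v : (arrays st 1 v + infty) %% (infty + 1) = dh st v.
Proof. by []. Qed.

Definition relaxed (u v : 'I_n) (st : state) : state :=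
  let d := dh st u + 1 in
  let mv : bool := d %/ delta < dh st v %/ delta in
  let mv' : bool := (d - 1) %/ delta < (dh st v - 1) %/ delta in
  set_cell 1 v (d + 1)
  (set_reg 8 (regs st 8 + 1)
  (set_cell 6 (regs st 8) v
  (set_cell 2 v 1
  (set_reg 7 (0 < regs st 7 + (mv + mv'))
  (set_cell 3 v (0 < arrays st 3 v + mv) st))))).

Lemma wp_relax E F (u v : 'I_n) st (Q : nat -> state -> Prop) :
  inv E F st -> regs st 2 = u -> regs st 3 = v ->
  ((u, v) \in E -> dh st u + 1 < dh st v ->
     forall t, t <= 150 -> Q t (relaxed u v st)) ->
  (((u, v) \in E -> dh st v <= dh st u + 1) -> forall t, t <= 150 -> Q t st) ->
  wp relax_cmd Q st.
Proof.
move=> I ru rv Qdrop Qskip.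
have [w1 w2 w3 w4] := word_bounds.
have M6 := inv_infty I; have ltu := ltn_ord u; have ltv := ltn_ord v.
have eu := inv_est I u; have ev := inv_est I v.
have lu := dh_le n delta st u; have lv := dh_le n delta st v.
have lun : u * n + v < n * n by nia.
have lsp : regs st 8 <= U.
  by apply: leq_trans (inv_pot I); rewrite /potential leq_addl.
have l3 := inv_full I v; have l7 := inv_flag I.
have c1 : 1 < 2 ^ w by lia.
have c0 : 0 < 2 ^ w by lia.
have [rn rd] := (inv_n I, inv_delta I).
have ae := inv_adj I u v; have le := leq_b1 ((u, v) \in E).
apply: wp_if => /=; first by solve_no_overflow ru rv rn M6 rd ae dh_def.
  rewrite ru rv rn M6 ae !dh_def muln_eq0 negb_or !eqb0 !negbK => /andP[uvE lt_uv].
  apply: wp_seq; apply: wp_write; [by []|by solve_no_overflow ru rv rn M6 rd ae dh_def|].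
  apply: wp_seq; apply: wp_assign; first by solve_no_overflow ru rv rn M6 rd ae dh_def.
  apply: wp_seq; apply: wp_write => //=.
  apply: wp_seq; apply: wp_write => //=.
  apply: wp_seq; apply: wp_assign; first by solve_no_overflow ru rv rn M6 rd ae dh_def.
  apply: wp_write => //=; first by solve_no_overflow ru rv rn M6 rd ae dh_def.
  rewrite /= ru rv M6 rd !dh_def.
  apply: Qdrop => //.
rewrite ru rv rn M6 ae !dh_def => /eqP; rewrite muln_eq0 !eqb0 -leqNgt => h.
apply: wp_skip; apply: Qskip => // uvE; move: h; by rewrite uvE.
Qed.

Lemma dh_relaxed (u v : 'I_n) st x : dh st u + 1 < dh st v ->
  dh (relaxed u v st) x = if x == v then dh st u + 1 else dh st x.
Proof.
move=> lt_uv; case: eqP => [->|/eqP ne].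
  apply: dh_finite; last by rewrite /= eqxx.
  by have := dh_le n delta st v; lia.
by rewrite -!dh_def /= (negbTE ne).
Qed.

Lemma pot_relaxed (u v : 'I_n) st : dh st u + 1 < dh st v ->
  pot (relaxed u v st) <= pot st.
Proof.
move=> lt_uv; set st' := relaxed u v st.
pose f (x : 'I_n) := vertex_pot n delta D (dh st' x) (arrays st' 2 x) (arrays st' 3 x).
pose g (x : 'I_n) := vertex_pot n delta D (dh st x) (arrays st 2 x) (arrays st 3 x).
have eq_fg (x : 'I_n) : x != v -> f x = g x.
  move=> ne; rewrite /f /g /st' dh_relaxed //=.
  by have -> : (x == v :> nat) = false by apply: negbTE.
have := sum_update eq_fg.
have := @vertex_pot_drop n delta D delta_gt0 _ _ (arrays st 2 v) (arrays st 3 v)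
  (regs st 7) _ _ lt_uv erefl erefl.
rewrite {2}/f /st' dh_relaxed // eqxx /= !eqxx /= -/(g v).
rewrite /potential -/st' /= -/f -/g.
move: (vertex_pot _ _ _ _ _ _) (g v) (infty.+1 * _) (infty.+1 * _) => a b c d.
by move: (\sum_x f x) (\sum_x g x) (regs st 8); lia.
Qed.

(** The vertex [v] becomes dirty and is stacked, and for edges into [v] the estimate only falls. If
    register 7 stays 0, [v] has kept its row in the lists; if its flag in array 3 stays 0, it has
    kept its bucket, so the bound for its successors is unchanged. *)
Lemma inv_relaxed E F (u v : 'I_n) st :
  inv E F st -> (u, v) \in E -> dh st u + 1 < dh st v ->
  inv E F (relaxed u v st).
Proof.
move=> I uvE lt_uv.
have dhE x := @dh_relaxed u v st x lt_uv.
have dh_anti x : dh (relaxed u v st) x <= dh st x by rewrite dhE; case: eqP => // ->; lia.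
have [lu lv] := (dh_le n delta st u, dh_le n delta st v).
have s0 : dh st s = 0 by apply: dh_finite => //; exact: inv_source I.
have v_s : v != s by apply/eqP => vs; move: lt_uv; rewrite vs s0.
have u_v : u != v by apply/eqP => uv; move: lt_uv; rewrite uv; lia.
have u_v' : (u == v :> nat) = false by apply: negbTE.
have dhu : dh (relaxed u v st) u = dh st u by rewrite dhE u_v'.
have eu : 0 < arrays st 1 u.
  by rewrite lt0n; apply/eqP => /(dh_unreached n delta); lia.
have [I0 I4 I5 I6 Iadj Iest Isrc Idirty Ifull Iflag Isound Istack Ipot Ib Iex Il Iq] := I.
have fl0 : regs (relaxed u v st) 7 = 0 ->
  [/\ regs st 7 = 0, (dh st u + 1) %/ delta = dh st v %/ delta
    & (dh st u + 1 - 1) %/ delta = (dh st v - 1) %/ delta].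
  have l1 : (dh st u + 1) %/ delta <= dh st v %/ delta by apply: leq_div2r; lia.
  have l2 : (dh st u + 1 - 1) %/ delta <= (dh st v - 1) %/ delta by apply: leq_div2r; lia.
  rewrite /=; move: l1 l2; set a := _ %/ _; set b := _ %/ _; set c := _ %/ _.
  set d := _ %/ _; clearbody a b c d; clear; move=> h1 h2 h3; split; lia.
have lbkt : regs (relaxed u v st) 7 = 0 -> forall x : 'I_n,
    (dh (relaxed u v st) x - 1) %/ delta = (dh st x - 1) %/ delta.
  by move=> /fl0[_ _ e] x; rewrite dhE; case: eqP => // ->.
split => //.
- by move=> x /=; case: eqP => // _; lia.
- by rewrite /= eq_sym (negbTE (v_s : v != s :> nat)).
- by move=> x /=; case: eqP.
- by move=> x /=; case: eqP => // _; apply: leq_b1.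
- exact: leq_b1.
- move=> x; rewrite dhE /=; case: (eqVneq (x : nat) v) => [/val_inj -> _|_]; last exact: Isound.
  have [|p [pp lp sp]] := Isound u; first by rewrite -lt0n.
  exists (rcons p v); rewrite rcons_path last_rcons size_rcons pp lp; split => //.
  by rewrite addn1.
- move=> j /=; case: eqP => [_ _|ne]; first exact: ltn_ord.
  by move=> lt_j; apply: Istack; lia.
- exact: leq_trans (pot_relaxed lt_uv) Ipot.
- move=> x y xyE Fxy full0.
  have full0' : arrays st 3 x = 0.
    by move: full0 => /=; case: eqP => // -> /eqP; rewrite eqb0; lia.
  apply: leq_trans (dh_anti _) _.
  apply: leq_trans (Ib _ _ xyE Fxy full0') _.
  rewrite dhE leq_mul2l ltnS; apply/orP; right.
  case: eqP => // e; move: full0; rewrite e /= eqxx /= => /eqP.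
  by rewrite eqb0 -leqNgt leqn0 addn_eq0 eqb0 -leqNgt => /andP[_].
- move=> x y xyE Fxy dirty0.
  have ne : (x : nat) != v by apply/eqP => e; move: dirty0; rewrite e /= eqxx.
  apply: leq_trans (dh_anti _) _; rewrite [dh _ x]dhE (negbTE ne).
  by apply: Iex => //; move: dirty0; rewrite /= (negbTE ne).
- move=> f0 b le_b; have [f0' _ _] := fl0 f0.
  have [h1 h2 h3] := Il f0' b le_b; split => //=.
  + by rewrite h1; apply: eq_card => x; rewrite !inE lbkt.
  + by move=> x; rewrite lbkt //; apply: h3.
- move=> f0 x dx; have [f0' fb _] := fl0 f0.
  case: (eqVneq (x : nat) v) => [e _|ne].
    by exists (regs st 8); rewrite /= ?eqxx ?addn1.
  rewrite /scannable dhE /= (negbTE ne) => el.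
  have [|j lt_j ej] := Iq f0' x _ el; first by move: dx; rewrite /= (negbTE ne).
  by exists j; [lia|rewrite /= ltn_eqF].
Qed.

Lemma wp_relax_inv E F (u v : 'I_n) st (Q : nat -> state -> Prop) :
  inv E F st -> regs st 2 = u -> regs st 3 = v ->
  (forall t st', t <= 150 -> inv E F st' -> pot st' <= pot st ->
     ((u, v) \in E -> dh st' v <= dh st u + 1) -> dh st' u = dh st u ->
     (forall x, dh st' x <= dh st x) ->
     (forall r, r \notin [:: 7; 8] -> regs st' r = regs st r) ->
     arrays st' 5 = arrays st 5 -> Q t st') ->
  wp relax_cmd Q st.
Proof.
move=> I ru rv QQ; apply: (wp_relax I ru rv) => [uvE lt_uv|h] t le_t.
  have dhE := dh_relaxed _ lt_uv.
  have ne : (u == v :> nat) = false.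
    by apply/eqP => e; move: lt_uv; rewrite e; lia.
  apply: QQ => //.
  - exact: inv_relaxed.
  - exact: pot_relaxed.
  - by rewrite dhE eqxx.
  - by rewrite dhE ne.
  - by move=> x; rewrite dhE; case: eqP => // ->; lia.
  - by move=> r; rewrite !inE negb_or /= => /andP[/negbTE -> /negbTE ->].
by apply: QQ.
Qed.

(** * Scanning the out-edges of a vertex *)

Lemma inv_set_reg E F st x k : x \notin [:: 0; 4; 5; 6; 7; 8] ->
  inv E F st -> inv E F (set_reg x k st).
Proof.
move=> nx [I0 I4 I5 I6 Iadj Iest Isrc Idirty Ifull Iflag Isound Istack Ipot Ib Iex Il Iq].
have hr y : y \in [:: 0; 4; 5; 6; 7; 8] -> regs (set_reg x k st) y = regs st y.
  by move=> hy /=; case: eqP => // e; move: nx; rewrite -e hy.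
by split; rewrite ?hr //; rewrite /potential !hr.
Qed.

(** A relaxed edge satisfies both edge conditions, since one level above [a] is never beyond the end
    of the bucket of [a]. *)
Lemma inv_strengthen (E : {set 'I_n * 'I_n}) (F F' : rel 'I_n) st :
  (forall a b, (a, b) \in E -> F' a b -> ~~ F a b -> dh st b <= dh st a + 1) ->
  inv E F st -> inv E F' st.
Proof.
move=> h [I0 I4 I5 I6 Iadj Iest Isrc Idirty Ifull Iflag Isound Istack Ipot Ib Iex Il Iq].
split => // u v uvE F'uv; (have [Fuv|/(h _ _ uvE F'uv) le_v] := boolP (F u v)).
- exact: (Ib u v uvE Fuv).
- by move=> _; apply: leq_trans le_v _; rewrite addn1 mulnC ltn_ceil.
- exact: (Iex u v uvE Fuv).
- by move=> _; rewrite addn1 in le_v.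
Qed.

(* [item] enumerates the vertices visited by the loop of [scan_cmd]. *)
Lemma wp_scan_loop E (u : 'I_n) st (lim mode du : nat) (a5 : nat -> nat) :
  let item j := if mode != 0 then j else a5 (du %/ delta * n + j) in
  inv E (fun a _ => a != u) st ->
  regs st 2 = u -> regs st 9 = 0 -> regs st 10 = lim -> regs st 11 = mode ->
  lim <= n -> dh st u = du -> arrays st 5 = a5 ->
  (forall j, j < lim -> item j < n) ->
  (forall v : 'I_n, (u, v) \in E ->
     dh st v <= du + 1 \/ exists2 j, j < lim & item j = v) ->
  wp (While (Bin OpLt (Reg 9) (Reg 10))
          (Seq (If (Reg 11) (Assign 3 (Reg 9))
                 (Assign 3 (Read 5 (Bin OpAdd (Bin OpMul
                    (bucket_expr (dist_expr (Reg 2))) (Reg 0)) (Reg 9)))))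
          (Seq relax_cmd
               (Assign 9 (succ_expr (Reg 9))))))
    (fun t st' => inv E (fun _ _ => true) st' /\ t + 200 * pot st' <= 200 * pot st + 200 * lim + 10) st.
Proof.
move=> item I r2 r9 r10 r11 le_lim eu e5 hitem hpend.
have [w1 w2 w3 w4] := word_bounds.
(* All edges out of [u] count as pending during the loop; the last clause says that each is already
   relaxed or has its head later in the enumeration. *)
pose J st := [/\ inv E (fun a _ => a != u) st,
  [/\ regs st 2 = u, regs st 9 <= lim, regs st 10 = lim & regs st 11 = mode],
  dh st u = du, arrays st 5 = a5 &
  forall v : 'I_n, (u, v) \in E ->
     dh st v <= du + 1 \/ exists2 j, regs st 9 <= j < lim & item j = v].
apply: (@wp_mono _ _ _ _ (fun t st' => [/\ J st', exact_eval eps st' (Bin OpLt (Reg 9) (Reg 10)) = 0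
   & t + (200 * pot st' + 200 * (lim - regs st' 9)) <= (200 * pot st + 200 * (lim - regs st 9)) + 4])).
  move=> t st' [[I' [r2' r9' r10' r11'] du' a5' pend'] /= /eqP]; rewrite eqb0 -leqNgt r10' => le9.
  rewrite r9 => cost; split; last by lia.
  apply: inv_strengthen I' => a b abE _; rewrite negbK => /eqP ea; subst a.
  rewrite du'; case: (pend' b abE) => // -[j]; lia.
apply: wp_while; last first.
- split => //; rewrite ?r9 // => v uvE; exact: hpend.
- move=> {st I r2 r9 r10 r11 eu e5 hpend} st [I [r2 r9 r10 r11] eu e5 hpend] /=.
  rewrite eqb0 negbK r10 => lt9.
  set i := regs st 9 in r9 lt9 hpend *.
  have lt_item := hitem i lt9.
  pose v : 'I_n := Ordinal lt_item.
  have [[M6 rn] rd] := (inv_infty I, inv_n I, inv_delta I).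
  have Iest := inv_est I u.
  apply: wp_seq.
  suff step (x t : nat) : x = v -> t <= 20 -> wp (Seq relax_cmd (Assign 9 (succ_expr (Reg 9))))
      (fun t2 st2 => J st2 /\
         (3 + (t + t2)).+1 + (200 * pot st2 + 200 * (lim - regs st2 9)) <=
         200 * pot st + 200 * (lim - i)) (set_reg 3 x st).
    have le_du : du %/ delta * n <= infty * n.
      by rewrite leq_mul2r bucket_le ?orbT // -eu dh_le.
    apply: wp_if => //=; rewrite r11 => em; apply: wp_assign => //=.
    + by apply: step => //; rewrite /v /= /item em.
    + rewrite r2 M6 rn rd dh_def eu; repeat (split => //); try lia.
      by have := dh_le n delta st u; rewrite eu; lia.
    + rewrite r2 M6 rn rd dh_def eu -/i e5.
      by apply: step => //; rewrite /v /= /item em.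
  move=> {x}-> le_t; apply: wp_seq.
  apply: (@wp_relax_inv E (fun a _ => a != u) u v) => //; first exact: inv_set_reg.
  move=> t1 st1 le_t1 I1 le_pot hv hu hle hr h5; apply: wp_assign => /=.
    by rewrite hr //= -/i; repeat (split => //); lia.
  have r9' : regs st1 9 = i by rewrite hr.
  split; last first.
    have -> : pot (set_reg 9 (regs st1 9 + 1) st1) = pot st1 by [].
    rewrite r9'; move: le_pot; have -> : pot (set_reg 3 v st) = pot st by [].
    move: (pot _) (pot _) => p1 p2; lia.
  split => //.
  + exact: inv_set_reg.
  + by rewrite /= r9' !hr //= ; split => //; lia.
  + by rewrite -eu; exact: hu.
  + by rewrite /= h5.
  + move=> x uxE; rewrite /= r9'.
    have [le_x|[j lt_j ej]] := hpend x uxE.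
      by left; apply: leq_trans le_x; apply: hle.
    have [e|ne] := eqVneq j i.
      left; have ex : x = v by apply: val_inj; rewrite /= -ej e.
      rewrite ex in uxE *; rewrite -eu; exact: hv.
    by right; exists j => //; lia.
- by move=> st0 [_ [_ _ _ _] _ _ _] /=; repeat (split => //); lia.
Qed.

Local Notation all_edges := (fun _ _ : 'I_n => true).

Lemma stack_height_le E F st : inv E F st -> regs st 8 <= U.
Proof. by move=> I; apply: leq_trans (inv_pot I); rewrite /potential leq_addl. Qed.

Definition popped (u : nat) (st : state) : state :=
  set_reg 2 u (set_reg 8 (regs st 8 - 1) st).

(** [inv_queue] demands stack entries only for dirty scannable vertices, and the discarded vertex is
    not one. *)
Lemma inv_popped E F st (u : 'I_n) :
  inv E F st -> 0 < regs st 8 -> arrays st 6 (regs st 8 - 1) = u ->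
  ~~ ((arrays st 2 u != 0) && eligible st u) -> inv E F (popped u st).
Proof.
move=> I sp_gt0 top nel.
have [I0 I4 I5 I6 Iadj Iest Isrc Idirty Ifull Iflag Isound Istack Ipot Ib Iex Il Iq] := I.
split => //.
- by move=> j /= lt_j; apply: Istack; lia.
- apply: leq_trans Ipot; rewrite /potential /= leq_add2l; exact: leq_subr.
- move=> f0 x dx ex; have [j lt_j ej] := Iq f0 x dx ex.
  exists j => //=; have : j != regs st 8 - 1; last by lia.
  apply: contraNneq nel => e; have xu : x = u by apply: val_inj; rewrite /= -ej e.
  by rewrite -xu dx.
Qed.

Lemma pot_popped u st : 0 < regs st 8 -> (pot (popped u st)).+1 = pot st.
Proof.
move=> sp_gt0; rewrite /potential /=; set a := \sum_(_ < _) _; set b := 4 * _.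
clearbody a b; lia.
Qed.

Definition scan_start (u lim : nat) (st : state) : state :=
  set_reg 9 0 (set_cell 3 u 0 (set_cell 2 u 0
    (set_reg 10 lim (set_reg 11 (arrays st 3 u) (popped u st))))).

Lemma pot_scan_start (u : 'I_n) lim st : 0 < regs st 8 -> arrays st 2 u = 1 ->
  pot (scan_start u lim st) +
    2 * (delta * delta + n * (dh st u <= D) + arrays st 3 u * n) + 1 = pot st.
Proof.
move=> sp_gt0 du; rewrite -(pot_popped u sp_gt0).
set st1 := scan_start u lim st; set st' := popped u st.
pose f (x : 'I_n) := vertex_pot n delta D (dh st1 x) (arrays st1 2 x) (arrays st1 3 x).
pose g (x : 'I_n) := vertex_pot n delta D (dh st' x) (arrays st' 2 x) (arrays st' 3 x).
have eq_fg (x : 'I_n) : x != u -> f x = g x.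
  move=> ne; rewrite /f /g /st1 /=.
  by have -> : (x == u :> nat) = false by apply: negbTE.
have := sum_update eq_fg.
rewrite {2}/f {1}/g /vertex_pot /= !eqxx /= du.
have -> : dh st1 u = dh st u by [].
have -> : dh st' u = dh st u by [].
rewrite /potential -/f -/g /=.
set a := \sum_x _; set b := \sum_x _; set c := 4 * _; set d := n * _; set e := _ * n.
set x := 6 * _; set k := delta * delta; clearbody a b c d e x k; lia.
Qed.

Lemma inv_scan_start E (u : 'I_n) lim st :
  inv E all_edges st -> 0 < regs st 8 -> arrays st 6 (regs st 8 - 1) = u ->
  arrays st 2 u = 1 ->
  inv E (fun a _ => a != u) (scan_start u lim st).
Proof.
move=> I sp_gt0 top du.
have [I0 I4 I5 I6 Iadj Iest Isrc Idirty Ifull Iflag Isound Istack Ipot Ib Iex Il Iq] := I.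
split => //.
- by move=> x /=; case: eqP.
- by move=> x /=; case: eqP.
- by move=> j /= lt_j; apply: Istack; lia.
- by apply: leq_trans Ipot; rewrite -(pot_scan_start lim sp_gt0 du) -addnA leq_addr.
- move=> x y xyE ne; have ne' : (x == u :> nat) = false by apply: negbTE.
  by rewrite /= ne'; apply: Ib.
- move=> x y xyE ne; have ne' : (x == u :> nat) = false by apply: negbTE.
  by rewrite /= ne'; apply: Iex.
- move=> f0 x /=; case: eqP => // ne dx.
  rewrite /scannable /=; have -> : (x == u :> nat) = false by apply/eqP.
  move=> ex; have [j lt_j ej] := Iq f0 x dx ex.
  exists j => //; have : j != regs st 8 - 1; last by lia.
  by apply/eqP => e; case: ne; rewrite -ej e.
Qed.

Lemma wp_scan E (u : 'I_n) st :
  inv E all_edges st -> regs st 7 = 0 -> 0 < regs st 8 ->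
  arrays st 6 (regs st 8 - 1) = u -> arrays st 2 u = 1 -> eligible st u ->
  wp scan_cmd (fun t st' => inv E all_edges st' /\
    t + 200 * pot st' + 200 <= 200 * pot st) (popped u st).
Proof.
move=> I f0 sp_gt0 top du el.
have [w1 w2 w3 w4] := word_bounds.
have [[M6 rn] rd] := (inv_infty I, inv_n I, inv_delta I).
have Iest := inv_est I u; have le_dh := dh_le n delta st u.
have le_b : dh st u %/ delta <= infty by apply: bucket_le.
have [len_card len_lt len_all] := inv_lists I f0 le_b.
pose lim := if arrays st 3 u != 0 then n else arrays st 4 (dh st u %/ delta).
have le_len : arrays st 4 (dh st u %/ delta) <= n.
  by rewrite len_card -[X in _ <= X]card_ord max_card.
have le_lim : lim <= n by rewrite /lim; case: ifP.
suff main t : t <= 50 -> wp (Seq (Write 2 (Reg 2) (Const 0))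
  (Seq (Write 3 (Reg 2) (Const 0))
  (Seq (Assign 9 (Const 0))
       (While (Bin OpLt (Reg 9) (Reg 10))
          (Seq (If (Reg 11) (Assign 3 (Reg 9))
                 (Assign 3 (Read 5 (Bin OpAdd (Bin OpMul
                    (bucket_expr (dist_expr (Reg 2))) (Reg 0)) (Reg 9)))))
          (Seq relax_cmd
               (Assign 9 (succ_expr (Reg 9)))))))))
    (fun t' st' => inv E all_edges st' /\
       t + t' + 200 * pot st' + 200 <= 200 * pot st)
    (set_reg 10 lim (set_reg 11 (arrays st 3 u) (popped u st))).
  apply: wp_seq; apply: wp_assign => //=.
  apply: wp_seq; apply: wp_if => //= full_u; apply: wp_assign => //=.
  - apply: (@wp_mono _ _ _ _ (fun t' st' => inv E all_edges st' /\
       20 + t' + 200 * pot st' + 200 <= 200 * pot st)); first by move=> t st' [I' c]; split => //; lia.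
    by have := @main 20 isT; rewrite rn /lim full_u.
  - by rewrite M6 dh_def; repeat (split => //); lia.
  - apply: (@wp_mono _ _ _ _ (fun t' st' => inv E all_edges st' /\
       40 + t' + 200 * pot st' + 200 <= 200 * pot st)); first by move=> t st' [I' c]; split => //; lia.
    by have := @main 40 isT; rewrite M6 rd dh_def /lim full_u eqxx.
move=> le_t.
apply: wp_seq; apply: wp_write => //=; first by lia.
apply: wp_seq; apply: wp_write => //=; first by lia.
apply: wp_seq; apply: wp_assign => //=; first by lia.
apply: (@wp_mono _ _ _ _ (fun t' st' => inv E all_edges st' /\
   t' + 200 * pot st' <= 200 * pot (scan_start u lim st) + 200 * lim + 10)).
  move=> t' st' [I' cost]; split => //.
  have := pot_scan_start lim sp_gt0 du.
  have k1 : 0 < delta * delta by rewrite muln_gt0 delta_gt0.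
  (* One summand for each reason to scan: light bucket, level at most [D], full scan. The cleared
     flags release twice this sum; one half pays for the loop, the other for the overhead. *)
  have : lim <= delta * delta + n * (dh st u <= D) + arrays st 3 u * n.
    move: el; rewrite /scannable /lim; case: ifP => [fu _|/negbFE/eqP -> /=].
      by apply: leq_trans (leq_addl _ _); rewrite leq_pmull // lt0n.
    move=> /orP[->|lt_k]; last by lia.
    by rewrite muln1; lia.
  move: k1 cost; set k := delta * delta; set x := n * _; set y := _ * n.
  move: (pot _) (pot _) (pot _) => p1 p2 p3; clearbody k x y; lia.
apply: (@wp_scan_loop E u _ lim (arrays st 3 u) (dh st u) (arrays st 5)) => //.
- exact: inv_scan_start.
- by move=> j lt_j; case: ifP => fu; [lia|apply: len_lt; move: lt_j; rewrite /lim fu].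
- move=> v uvE; have [le_v|gt_v] := leqP (dh st v) (dh st u + 1); first by left.
  right; rewrite /lim; case: ifP => [fu|/negbFE/eqP fu]; first by exists v.
  (* Since [v] lies above level [d(u) + 1] but not beyond the end of the bucket of [u], it is in the
     scanned row. *)
  apply: len_all; have := inv_bucket I uvE isT fu; rewrite mulnC => le_v.
  have := leq_trunc_div (dh st u) delta.
  move: (dh st u %/ delta) le_v => b le_v le_b'.
  by apply/eqP; rewrite eqn_leq -ltnS ltn_divLR // leq_divRL //; lia.
Qed.

(** * Rebuilding the bucket lists *)

Lemma card_ord_iota (P : pred nat) : #|[set v : 'I_n | P v]| = count P (iota 0 n).
Proof.
by rewrite -sum1dep_card -(big_mkord P (fun=> 1)) sum1_count /index_iota subn0.
Qed.

(** What the two loops of the rebuild leave untouched; registers 7 and 8 change only after them. *)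
Definition same_core (st0 st : state) : Prop :=
  (forall x, x \in [:: 0; 4; 5; 6; 7; 8] -> regs st x = regs st0 x) /\
  (forall a, a < 4 -> arrays st a = arrays st0 a).

Lemma same_core_set_reg st0 st x k : x \notin [:: 0; 4; 5; 6; 7; 8] ->
  same_core st0 st -> same_core st0 (set_reg x k st).
Proof.
move=> nx [h1 h2]; split => // y hy /=; rewrite -h1 //.
by case: eqP => // e; move: nx; rewrite -e hy.
Qed.

Lemma same_core_set_cell st0 st a i k : 3 < a ->
  same_core st0 st -> same_core st0 (set_cell a i k st).
Proof.
move=> ha [h1 h2]; split => // b hb /=; rewrite -h2 //.
by have -> : (b == a) = false by lia.
Qed.

Lemma dh_same_core st0 st v : same_core st0 st -> dh st v = dh st0 v.
Proof. by move=> [_ h]; rewrite -!dh_def h. Qed.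

Lemma wp_refresh E st0 : inv E all_edges st0 -> regs st0 7 = 1 ->
  wp refresh_cmd (fun t st' => inv E all_edges st' /\
    t + 200 * pot st' + 100 <= 200 * pot st0) st0.
Proof.
move=> I f1.
have [w1 w2 w3 w4] := word_bounds.
have n_gt0 : 0 < n by apply: leq_ltn_trans (ltn_ord s).
have le_n : n <= infty by apply: leq_addr.
pose bk v := (dh st0 v - 1) %/ delta.
have bk_le v : bk v <= infty.
  by apply: bucket_le; apply: leq_trans (leq_subr _ _) (dh_le _ _ _ _).
pose J1 st := [/\ same_core st0 st, regs st 9 <= infty.+1
  & forall b, b < regs st 9 -> arrays st 4 b = 0].
pose J2 st := [/\ same_core st0 st, regs st 9 <= n,
  forall b, b <= infty -> arrays st 4 b = count (fun v => bk v == b) (iota 0 (regs st 9)),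
  (forall b i, b <= infty -> i < arrays st 4 b -> arrays st 5 (b * n + i) < n) /\
  (forall v, v < regs st 9 ->
     exists2 i, i < arrays st 4 (bk v) & arrays st 5 (bk v * n + i) = v)
  & forall j, j < regs st 9 -> arrays st 6 j = j].
apply: wp_seq; apply: wp_assign => /=; first by lia.
apply: wp_seq.
apply: (@wp_mono _ _ _ _ (fun t st => [/\ J1 st,
    exact_eval eps st (Bin OpLt (Reg 9) (succ_expr (Reg 6))) = 0 &
    t + 50 * (infty.+1 - regs st 9) <= 50 * (infty.+1 - 0) + 6])); last first.
  apply: (@wp_while _ _ _ _ _ J1 (fun st => 50 * (infty.+1 - regs st 9))).
  - move=> st [[h _] h9 _] /=; rewrite (h 6) // (inv_infty I); repeat (split => //); lia.
  - move=> st [h h9 hz] /=; have [h1 h2] := h; rewrite (h1 6) // (inv_infty I) eqb0 negbK => lt9.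
    apply: wp_seq; apply: wp_write => //=; first by lia.
    apply: wp_assign => /=; first by repeat (split => //); lia.
    split; last by lia.
    split => //=; [|by lia|].
      by apply: same_core_set_reg => //; apply: same_core_set_cell.
    move=> b lt_b; case: eqP => // ne; apply: hz; lia.
  - by split => //; apply: same_core_set_reg.
move=> t1 st1 [[sc1 le9 hz] /= /eqP]; have [h1 h2] := sc1.
rewrite (h1 6) // (inv_infty I) eqb0 -leqNgt => ge9 cost1.
apply: wp_seq; apply: wp_assign => /=; first by lia.
apply: wp_seq.
apply: wp_mono; last first.
  apply: (@wp_while _ _ _ _ _ J2 (fun st => 100 * (n - regs st 9))).
  - by move=> st _ /=; repeat (split => //); lia.
  - move=> st [sc h9 hlen [hlt hall] hst] /=.
    have [r2 a2] := sc; rewrite (r2 0) // (inv_n I) eqb0 negbK.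
    set i := regs st 9 in h9 hlen hall hst * => lt9.
    have M6 : regs st 6 = infty by rewrite r2 // (inv_infty I).
    have rn : regs st 0 = n by rewrite r2 // (inv_n I).
    have rd : regs st 4 = delta by rewrite r2 // (inv_delta I).
    have ei : arrays st 1 i <= infty by rewrite a2 //; exact: (inv_est I (Ordinal lt9)).
    have dhi : dh st i = dh st0 i by apply: dh_same_core.
    have le_dh := dh_le n delta st0 i.
    set b := bk i; have le_b : b <= infty := bk_le i.
    have len_lt : arrays st 4 b <= i.
      by rewrite hlen // -[X in _ <= X](size_iota 0) count_size.
    have le_bn : b * n <= infty * n by rewrite leq_mul2r le_b orbT.
    have rowE : (dh st i - 1) %/ delta = b by rewrite dhi.
    apply: wp_seq; apply: wp_assign => /=.
      by rewrite M6 -/i dh_def dhi; repeat (split => //); lia.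
    rewrite M6 rd -/i dh_def rowE.
    apply: wp_seq; apply: wp_write => //=.
      by rewrite rn; repeat (split => //); lia.
    apply: wp_seq; apply: wp_write => //=.
      by repeat (split => //); lia.
    apply: wp_seq; apply: wp_write => //=.
    apply: wp_assign => /=; first by repeat (split => //); lia.
    rewrite -/i rn.
    split; last by lia.
    (* Rows have length [n], so appending to row [b] cannot overwrite an entry of another row. *)
    have inj b' j : j < n -> (b' * n + j == b * n + arrays st 4 b) = (b' == b) && (j == arrays st 4 b).
      move=> lt_j; apply/eqP/andP => [e|[/eqP -> /eqP ->] //].
      have eb : b' = b.
        have := congr1 (divn^~ n) e; rewrite /= !divnMDl // !divn_small ?addn0 //; lia.
      by move: e; rewrite eb => /addnI ->.
    split => /=; [| by lia | | split |].
    + do 1![apply: same_core_set_reg => //]; do 3![apply: same_core_set_cell => //].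
      exact: same_core_set_reg.
    + move=> b' le_b'; rewrite addn1 -addn1 iotaD count_cat /= add0n addn0 -/b.
      rewrite -hlen // [b == b']eq_sym; case: eqP => [->|] /=; lia.
    + move=> b' j le_b'; case: (eqVneq b' b) => [-> |ne] /= lt_j.
        rewrite inj ?eqxx /=; last by lia.
        by case: eqP => // ne; apply: hlt => //; lia.
      have lt_len := lt_j; rewrite hlen // in lt_j.
      have lt_jn : j < n.
        by apply: leq_trans lt_j (leq_trans _ h9); rewrite -[X in _ <= X](size_iota 0) count_size.
      by rewrite inj // (negbTE ne) /=; apply: hlt.
    + move=> v lt_v; case: (eqVneq v i) => [->|ne].
        by exists (arrays st 4 b); rewrite -/b eqxx ?addn1.
      have [|j lt_j ej] := hall v _; first by lia.
      have lt_jn : j < n.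
        apply: leq_trans lt_j (leq_trans _ h9).
        by rewrite hlen // -[X in _ <= X](size_iota 0) count_size.
      exists j; first by case: eqP => // e; rewrite e in lt_j; lia.
      rewrite inj //; case: eqP => //= e; case: eqP => // e'.
      by move: lt_j; rewrite e e' ltnn.
    + by move=> j lt_j; case: eqP => // ne; apply: hst; lia.
  - split => //=; first exact: same_core_set_reg.
    + by move=> b le_b; apply: hz; lia.
    + by split => // b i le_b; rewrite hz //; lia.
move=> t2 st2 [[sc2 le9' hlen [hlt hall] hst] /= /eqP]; have [r2 a2] := sc2.
rewrite (r2 0) // (inv_n I) eqb0 -leqNgt subn0 => ge9' cost2.
have e9 : regs st2 9 = n by lia.
rewrite e9 in hlen hall hst cost2.
have dh2 v : dh st2 v = dh st0 v by apply: dh_same_core.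
apply: wp_seq; apply: wp_assign => //=; apply: wp_assign => //=; first by lia.
rewrite (r2 0) // (inv_n I).
set st3 := set_reg 7 0 (set_reg 8 n st2).
have dh3 v : dh st3 v = dh st0 v by apply: dh2.
(* Clearing register 7 releases [4 * infty.+1]; the new stack of height [n] takes back at most a
   quarter. *)
have pot3 : pot st3 + 3 * infty.+1 <= pot st0.
  have -> : pot st0 = \sum_(v < n) vertex_pot n delta D (dh st0 v) (arrays st0 2 v)
    (arrays st0 3 v) + 4 * (infty.+1 * regs st0 7) + regs st0 8 by [].
  rewrite f1 /potential /= !a2 //.
  rewrite (eq_bigr (fun v : 'I_n => vertex_pot n delta D (dh st0 v) (arrays st0 2 v)
    (arrays st0 3 v))); last by move=> v _; rewrite dh3.
  by move: (\sum_(v < n) _); lia.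
have [I0 I4 I5 I6 Iadj Iest Isrc Idirty Ifull Iflag Isound Istack Ipot Ib Iex Il Iq] := I.
split; last first.
  by move: pot3 cost1 cost2; move: (pot _) (pot _) => p q; lia.
split; rewrite /= ?r2 ?(a2 0) ?(a2 1) ?(a2 2) ?(a2 3) //.
- by move=> v; rewrite dh3; apply: Isound.
- by move=> j lt_j; rewrite hst.
- by apply: leq_trans Ipot; lia.
- by move=> u v; rewrite !dh3; apply: Ib.
- by move=> u v; rewrite !dh3; apply: Iex.
- move=> _ b le_b; rewrite /= hlen //; split.
  + rewrite -card_ord_iota; apply: eq_card => v; rewrite !inE dh3 //.
  + by move=> i; rewrite -hlen //; apply: hlt.
  + move=> v; rewrite dh3 => eb; have := hall v (ltn_ord v).
    by rewrite /bk eb hlen.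
- by move=> _ u _ _; exists u; rewrite ?hst.
Qed.

(** * The main loop and the estimates it leaves behind *)

Lemma wp_main E st : inv E all_edges st ->
  wp main_cmd (fun t st' => [/\ inv E all_edges st', regs st' 7 = 0, regs st' 8 = 0
    & t + 200 * pot st' <= 200 * pot st + 4]) st.
Proof.
move=> I.
have [w1 w2 w3 w4] := word_bounds.
apply: (@wp_mono _ _ _ _ (fun t st' => [/\ inv E all_edges st',
    exact_eval eps st' (Bin OpAdd (Reg 7) (Reg 8)) = 0 &
    t + 200 * pot st' <= 200 * pot st + 4])).
  move=> t st' [I' /= /eqP]; rewrite addn_eq0 => /andP[/eqP h7 /eqP h8] cost; split => //.
(* Every branch is paid: a rebuild by register 7, a scan by the flags of its vertex, a discarded
   entry by its unit of stack height. *)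
apply: (@wp_while _ _ _ _ _ (inv E all_edges) (fun st => 200 * pot st)) => // {I} {}st I.
  have := stack_height_le I; have := inv_flag I.
  by move=> h7 h8; repeat (split => //) => /=; lia.
have Iflag := inv_flag I; have lsp := stack_height_le I.
rewrite /= => guard; apply: wp_if => //=.
  move=> f1; apply: wp_mono (wp_refresh I _); last by lia.
  by move=> t st' [I' cost]; split => //; move: (pot _) (pot _) cost => p q; lia.
move=> f0; have sp_gt0 : 0 < regs st 8 by lia.
have lt_u : arrays st 6 (regs st 8 - 1) < n by apply: (inv_stack I); lia.
have [u eu] : exists u : 'I_n, arrays st 6 (regs st 8 - 1) = u by exists (Ordinal lt_u).
have [[[M6 rn] rd] rD] := (inv_infty I, inv_n I, inv_delta I, inv_D I).
have Iest := inv_est I u; have le_dh := dh_le n delta st u.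
have ldirty := inv_dirty I u; have lfull := inv_full I u.
have le_k : delta * delta <= infty by apply: leq_addl.
apply: wp_seq; apply: wp_assign => /=; first by repeat (split => //); lia.
apply: wp_seq; apply: wp_assign => //=.
rewrite eu -/(popped u st).
apply: wp_if => /=; rewrite M6 rd rD dh_def.
- repeat (split => //); gen_bools; try lia.
  by apply: leq_ltn_trans (leq_mul ldirty (leqnn _)) _; lia.
- rewrite muln_eq0 negb_or => /andP[du el].
  apply: wp_mono (@wp_scan E u st I f0 sp_gt0 eu _ _); [|by lia|].
    by move=> t st' [I' cost]; split => //; move: (pot _) (pot _) cost => p q; lia.
  move: el; rewrite /scannable !addn_eq0 !eqb0 addn1 ltnS.
  by rewrite !negb_and !negbK orbA.
- move=> e0; apply: wp_skip; split.
    apply: inv_popped => //; rewrite /scannable; move/eqP: e0.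
    rewrite muln_eq0 !addn_eq0 !eqb0 addn1 ltnS negb_and negbK !negb_or negbK.
    by rewrite -!leqNgt.
  by rewrite -(pot_popped u sp_gt0); move: (pot _) => p; lia.
Qed.

(** With an empty stack no vertex is both dirty and scannable. A clean [u] has exact out-edges; a
    dirty one fails all three scanning conditions, and its clear flag in array 3 gives the bound by
    [inv_bucket]. *)
Lemma at_rest E st (u v : 'I_n) :
  inv E all_edges st -> regs st 7 = 0 -> regs st 8 = 0 -> (u, v) \in E ->
  dh st v <= dh st u + 1 \/
  [/\ D < dh st u, ~~ light delta (fun x : 'I_n => (dh st x - 1) %/ delta) (dh st u)
    & dh st v <= delta * (dh st u %/ delta).+1].
Proof.
move=> I f0 sp0 uvE; have := inv_dirty I u; case du: (arrays st 2 u) => [|[|//]] _.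
  by left; rewrite addn1; apply: (inv_exact I).
have : ~~ eligible st u.
  by apply/negP => /(inv_queue I f0 du)[j]; rewrite sp0.
rewrite !negb_or negbK -ltnNge -leqNgt => /and3P[/eqP fu lt_D heavy].
right; split => //; last exact: (inv_bucket I).
have [h _ _] := inv_lists I f0 (bucket_le (dh_le n delta st u)).
by rewrite /light -leqNgt /bucket_size -h.
Qed.

Lemma dh_source E F st : inv E F st -> dh st s = 0.
Proof. by move=> I; apply: dh_finite => //; exact: inv_source I. Qed.

(** Inductively the predecessor has an estimate at most [D], which excludes the postponed case of
    [at_rest]. *)
Lemma dh_path_exact E st p :
  inv E all_edges st -> regs st 7 = 0 -> regs st 8 = 0 ->
  path (edge_rel E) s p -> size p <= D -> dh st (last s p) <= size p.
Proof.
move=> I f0 sp0; elim/last_ind: p => [|p v IH].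
  by rewrite /= (dh_source I).
rewrite rcons_path last_rcons size_rcons => /andP[pp e] lt_D.
have le_u := IH pp (ltnW lt_D).
by have [|[]] := at_rest I f0 sp0 e; lia.
Qed.

Hypothesis delta_cube : n <= delta * delta * delta.

Lemma dh_path E st p :
  inv E all_edges st -> regs st 7 = 0 -> regs st 8 = 0 ->
  path (edge_rel E) s p -> dh st (last s p) <= size p + delta * delta.
Proof.
move=> I f0 sp0 pp.
pose bk (x : 'I_n) := (dh st x - 1) %/ delta; pose g := light_below delta bk.
(* Induction on the estimates themselves would lose up to a bucket per edge. The number of light
   levels below grows by at most 1 per edge, and not at all across a postponed one. *)
suff : g (dh st (last s p)) <= size p.
  move=> le_g; apply: leq_trans (light_below_gap bk delta_gt0 delta_cube _) _.
  by rewrite leq_add2r.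
elim/last_ind: p pp => [|p v IH]; first by rewrite /= (dh_source I).
rewrite rcons_path last_rcons size_rcons => /andP[pp e].
have le_u := IH pp.
have [h|[_ heavy h]] := at_rest I f0 sp0 e.
  by apply: leq_trans (light_below_succ _ _ h) _; rewrite addn1 ltnS.
exact: leq_trans (leq_trans (light_below_heavy delta_gt0 heavy h) le_u) (leqnSn _).
Qed.

(** * Insertions, initialization and complete runs *)

Lemma mxcell_inj (a b x y : 'I_n) : (a * n + b == x * n + y) = ((a, b) == (x, y)).
Proof.
have n_gt0 : 0 < n by apply: leq_ltn_trans (ltn_ord s).
apply/eqP/eqP => [e|[-> ->] //].
have ea : a = x.
  apply: val_inj; have := congr1 (divn^~ n) e.
  by rewrite /= !divnMDl // !divn_small ?addn0.
by move: e; rewrite ea => /addnI/val_inj ->.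
Qed.

Lemma walk_mono (E E' : {set 'I_n * 'I_n}) v d : E \subset E' ->
  walk s E v d -> walk s E' v d.
Proof.
move=> /fintype.subsetP sub [p [pp lp sp]]; exists p; split => //.
by apply: sub_path pp => a b; apply: sub.
Qed.

(** Right after the matrix is changed the new edge is the only pending one; relaxing it restores the
    full invariant for [wp_main]. *)
Lemma wp_update E st (e : 'I_n * 'I_n) : inv E all_edges st ->
  wp (alg_update incremental_sssp)
    (fun t st' => [/\ inv (e |: E) all_edges st', regs st' 7 = 0, regs st' 8 = 0 &
       t + 200 * pot st' <= 200 * pot st + 200]) (announce e st).
Proof.
case: e => x y I.
have [w1 w2 w3 w4] := word_bounds.
have rn := inv_n I; have ltx := ltn_ord x; have lty := ltn_ord y.
have lxy : x * n + y < n * n by nia.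
have I1 : inv ((x, y) |: E) (fun a b => (a, b) != (x, y))
    (set_cell 0 (x * n + y) 1 (announce (x, y) st)).
  have [I0 I4 I5 I6 Iadj Iest Isrc Idirty Ifull Iflag Isound Istack Ipot Ib Iex Il Iq] := I.
  split => //.
  - move=> a b; rewrite /= mxcell_inj finset.in_setU1; case: eqP => //= _; exact: Iadj.
  - by move=> v ev; apply: walk_mono (Isound v ev); apply: finset.subsetUr.
  - by move=> a b; rewrite finset.in_setU1 => /orP[->|abE _] //; apply: Ib.
  - by move=> a b; rewrite finset.in_setU1 => /orP[->|abE _] //; apply: Iex.
apply: wp_seq; apply: wp_write => //=.
- by rewrite rn; repeat (split => //); lia.
- by lia.
rewrite rn; apply: wp_seq; apply: (wp_relax_inv I1) => //.
move=> t st1 le_t I1' le_pot hv hu _ _ _.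
have {}I1' : inv ((x, y) |: E) all_edges st1.
  apply: inv_strengthen I1' => a b _ _; rewrite negbK => /eqP[-> ->].
  by rewrite hu; apply: hv; rewrite finset.setU11.
apply: wp_mono (wp_main I1') => t' st' [I' f0 sp0 cost]; split => //.
have {}le_pot : pot st1 <= pot st := le_pot.
by move: (pot _) (pot _) (pot _) le_pot cost => p1 p2 p3; lia.
Qed.

Definition initialized (st : state) : state :=
  set_reg 7 1 (set_cell 3 s 1 (set_cell 2 s 1 (set_cell 1 s 1 st))).

(** The initial potential: the future decreases of all vertices from infinity, the two flags of the
    source, and the stale lists. *)
Hypothesis U_ge :
  6 * (n * drop_weight n delta D infty) + 2 * (delta * delta + n + n)
  + 4 * infty.+1 <= U.

Lemma inv_initialized (E : {set 'I_n * 'I_n}) st :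
  regs st 0 = n -> regs st 4 = delta -> regs st 5 = D -> regs st 6 = infty ->
  regs st 8 = 0 ->
  (forall i, arrays st 0 i = [exists p in E, i == p.1 * n + p.2]) ->
  (forall a i, 0 < a -> arrays st a i = 0) ->
  inv E all_edges (initialized st).
Proof.
move=> r0 r4 r5 r6 r8 adj zero.
have n_gt0 : 0 < n by apply: leq_ltn_trans (ltn_ord s).
have dhs : dh (initialized st) s = 0 by apply: dh_finite; rewrite //= eqxx.
have dhx (x : 'I_n) : x != s -> dh (initialized st) x = infty.
  move=> ne; apply: dh_unreached; rewrite /= zero //.
  by have -> : (x == s :> nat) = false by apply: negbTE.
split => //.
- move=> u v; rewrite /= adj; congr nat_of_bool; apply/existsP/idP => [[[a b]]|uvE].
    by rewrite /= mxcell_inj => /andP[abE /eqP ->].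
  by exists (u, v); rewrite uvE eqxx.
- by move=> v /=; case: eqP => _; rewrite ?zero //; rewrite /inf_value; lia.
- by rewrite /= eqxx.
- by move=> v /=; case: eqP => _; rewrite ?zero.
- by move=> v /=; case: eqP => _; rewrite ?zero.
- move=> v /=; case: (eqVneq (v : nat) s) => [/val_inj -> _|_]; last by rewrite zero.
  by rewrite dhs; exists [::].
- by move=> j; rewrite /= r8.
- apply: leq_trans U_ge; rewrite /potential /= r8 addn0 muln1 leq_add2r.
  rewrite (bigD1 s) //= dhs eqxx addnC; apply: leq_add; last first.
    by rewrite /vertex_pot /drop_weight /= !(muln0, min0n, div0n, muln1, mul1n, addn0).
  rewrite (eq_bigr (fun=> 6 * drop_weight n delta D infty)); last first.
    move=> v ne; rewrite dhx // !zero //.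
    by have -> : (v == s :> nat) = false by apply: negbTE.
  rewrite sum_nat_const mulnCA leq_mul2l; apply/orP; right.
  by rewrite leq_mul2r -[X in _ <= X]card_ord max_card orbT.
(* The source has its flags set, and any other tail is at infinity, which no estimate exceeds. *)
- move=> u v _ _ /=; case: eqP => // /eqP ne _; rewrite (dhx u) //.
  by apply: leq_trans (dh_le _ _ _ _) _; rewrite mulnC ltnW // ltn_ceil.
- move=> u v _ _ /=; case: eqP => // /eqP ne _; rewrite (dhx u) //.
  by apply: leq_trans (dh_le _ _ _ _) _.
Qed.

Hypothesis delta_min : forall i, i < delta -> i * i * i < n.
Hypothesis D_min : forall i, i < D ->
  i < infty /\ (i%:R * eps <= (delta * delta)%:R)%R.
Hypothesis D_stop : infty <= D \/ ((delta * delta)%:R < D%:R * eps)%R.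

Lemma wp_init (E : {set 'I_n * 'I_n}) :
  wp (alg_init incremental_sssp)
    (fun t st => [/\ inv E all_edges st, regs st 7 = 0, regs st 8 = 0 &
       t + 200 * pot st <= 200 * U + 20 * (delta + D) + 100]) (init_state E s).
Proof.
have [w1 w2 w3 w4] := word_bounds.
have le_d : delta <= delta * delta by apply: leq_pmulr.
have le_k : delta * delta <= infty by apply: leq_addl.
have n_gt0 : 0 < n by apply: leq_ltn_trans (ltn_ord s).
(* The guard is also evaluated at [delta], whose cube may exceed [n]; minimality bounds it by
   [8 * n]. *)
have cube_lt i : i <= delta -> i * i * i < 2 ^ w.
  rewrite leq_eqVlt => /orP[/eqP ->|/delta_min lt_i]; last by lia.
  have d1 : delta.-1 * delta.-1 * delta.-1 < n by apply: delta_min; lia.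
  have : delta * delta * delta <= 8 * n by case: (delta) delta_gt0 d1 => // [[|d]] //= _; nia.
  by rewrite /inf_value in w2; lia.
apply: wp_seq; apply: wp_mono; last first.
  apply: (@wp_search _ _ _ 4 _ (fun i => n <= i * i * i) delta) => //.
  - by move=> i /delta_min; rewrite ltnNge.
  - by lia.
  - move=> st [h1 h2] le4; rewrite /= (h1 0) //= -ltnNge eqb0 negbK; split => //.
    have := cube_lt _ le4; have : regs st 4 * regs st 4 <= delta * delta by apply: leq_mul.
    by repeat (split => //); lia.
move=> t1 st1 [[r1 a1] r4 cost1].
apply: wp_seq; apply: wp_assign => /=.
  by rewrite (r1 0) //= r4; repeat (split => //); rewrite /inf_value in w2; lia.
rewrite (r1 0) //= r4 -/infty.
apply: wp_seq; apply: wp_mono; last first.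
  apply: (@wp_search _ _ _ 5 _
    (fun i => (infty <= i) || ~~ (i%:R * eps <= (delta * delta)%:R)%R) D) => //.
  - by case: D_stop => [->//|lt]; rewrite -ltNge lt orbT.
  - by move=> i /D_min[lt_i le_i]; rewrite negb_or -ltnNge lt_i negbK.
  - by lia.
  - by rewrite /= r1.
  - move=> st [h1 h2] le5; rewrite /= !(h1 4) // ?(h1 6) //= r4.
    rewrite muln_eq0 !eqb0 !negb_or -ltnNge !negbK; split => //.
    by repeat (split => //); gen_bools; nia.
move=> t2 st2 [[r2 a2] r5 cost2].
have rs : regs st2 1 = s by rewrite r2 //= r1.
do 3![apply: wp_seq; apply: wp_write => //=; first by lia].
apply: wp_seq; apply: wp_assign => //=; first by lia.
rewrite rs -/(initialized st2).
have I : inv E all_edges (initialized st2).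
  apply: inv_initialized; rewrite ?r5 ?(r2 _) ?r4 //= ?r1 //.
  - by move=> i; rewrite a2 /= a1.
  - by move=> a i a_gt0; rewrite a2 /= a1 /=; case: eqP a_gt0 => // ->.
apply: wp_mono (wp_main I) => t st [I' f0 sp0 cost]; split => //.
move: cost1 cost2 (inv_pot I) cost => /=; move: (pot _) (pot _) => p q; lia.
Qed.

Lemma run_incremental E us :
  exists T st, [/\ run incremental_sssp w eps E s us T st,
    inv (insert_all E us) all_edges st, regs st 7 = 0, regs st 8 = 0 &
    T + 200 * pot st <= 200 * U + 20 * (delta + D) + 100 + 200 * size us].
Proof.
elim/last_ind: us => [|us e [T [st [rT I f0 sp0 cost]]]].
  have [t [st [ex [I f0 sp0 cost]]]] := wp_init E.
  exists t, st; split => //; [exact: RunInit|..|by rewrite addn0].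
  have -> // : insert_all E [::] = E.
  by apply/finset.setP => u; rewrite !inE orbF.
have [t [st' [ex [I' f0' sp0' cost']]]] := wp_update e I.
exists (T + t), st'; split => //; first exact: RunUpdate rT ex.
  have -> // : insert_all E (rcons us e) = e |: insert_all E us.
  by apply/finset.setP => u; rewrite !inE mem_rcons inE orbCA.
by rewrite size_rcons; move: (pot _) (pot _) cost cost' => p q; lia.
Qed.

(** The lower bound comes from the walk in [inv_sound]. The upper bound is shown against every path
    in the infimum. *)
Lemma estimate_correct E st (v : 'I_n) : (0 < eps)%R ->
  inv E all_edges st -> regs st 7 = 0 -> regs st 8 = 0 ->
  (dist R E s v <= estimate R st v)%E /\
  (estimate R st v <= (1 + eps)%:E * dist R E s v)%E.
Proof.
move=> eps_gt0 I f0 sp0; split.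
  rewrite /estimate; case e: (arrays st 1 v) => [|d]; first exact: leey.
  have ev : arrays st 1 v != 0 by rewrite e.
  have [p [pp lp sp]] := inv_sound I ev.
  apply: ge_ereal_inf; exists (size p)%:R%:E; first by exists p.
  rewrite lee_fin ler_nat; apply: leq_trans sp _.
  by have := @dh_reached n delta st v; rewrite (inv_est I v) andbT e => /(_ isT) [->].
rewrite /dist -ereal_inf_pZl; last by rewrite addr_gt0.
apply/ereal_infP => y /= [x [q [pq lq] <-] <-]; rewrite -EFinM.
(* A simple path has fewer than [n] edges, so the estimate is below [n + delta * delta], the value
   of infinity, and hence finite. *)
move: lq; case/shortenP: pq => p pp up sub_pq lp.
have le_pq : size p <= size q.
  by apply: uniq_leq_size sub_pq; case/andP: up.
have lt_pn : size p < n.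
  by rewrite -[X in _ < X]card_ord; move/card_uniqP: up => /= <-; apply: max_card.
have le_dh := dh_path I f0 sp0 pp; rewrite lp in le_dh.
have lt_dh : dh st v < infty by apply: leq_ltn_trans le_dh _; rewrite ltn_add2r.
rewrite /estimate; case e: (arrays st 1 v) => [|d].
  by move: lt_dh; rewrite (dh_unreached _ _ e) ltnn.
have ed : d = dh st v.
  by have := @dh_reached n delta st v; rewrite (inv_est I v) andbT e => /(_ isT) [->].
rewrite lee_fin ed.
apply: (@le_trans _ _ ((1 + eps) * (size p)%:R)%R); last first.
  by rewrite ler_pM2l ?ler_nat // addr_gt0.
rewrite mulrDl mul1r.
have [le_D|lt_D] := leqP (size p) D.
  have := dh_path_exact I f0 sp0 pp le_D; rewrite lp -(ler_nat R) => h.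
  by apply: le_trans h _; rewrite lerDl mulr_ge0 // ltW.
(* A path longer than [D] but shorter than [n] excludes [infty <= D]. The additive error
   [delta * delta] is then below [D * eps], hence below [eps] times the length. *)
have stop : ((delta * delta)%:R < D%:R * eps)%R.
  by case: D_stop => // le_D; move: lt_D lt_pn; rewrite /inf_value in le_D; lia.
move: le_dh; rewrite -(ler_nat R) natrD => le_dh; apply: le_trans le_dh _.
rewrite lerD2l; apply: le_trans (ltW stop) _.
by rewrite mulrC ler_pM2l // ler_nat ltnW.
Qed.

End Execution.

(** * Choice of the parameters *)

Lemma least_cube_root (n : nat) :
  exists delta, n <= delta * delta * delta /\ (forall i, i < delta -> i * i * i < n).
Proof.
have ex : exists d, n <= d * d * d.
  by exists n; case: n => // n; rewrite -mulnA leq_pmulr.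
by exists (ex_minn ex); case: ex_minnP => d le_d min; split => // i lt_i;
  rewrite ltnNge; apply/negP => /min; rewrite leqNgt lt_i.
Qed.

Lemma least_exactness_threshold (R : realType) (eps : R) (M k : nat) :
  exists D, [/\ D <= M,
    forall i, i < D -> i < M /\ (i%:R * eps <= k%:R)%R
  & M <= D \/ (k%:R < D%:R * eps)%R].
Proof.
pose P i := (M <= i) || ~~ (i%:R * eps <= k%:R)%R.
have ex : exists i, P i by exists M; rewrite /P leqnn.
exists (ex_minn ex); case: ex_minnP => D PD min; split.
- by apply: min; rewrite /P leqnn.
- move=> i lt_i; have : ~~ P i by apply: contraTN lt_i => /min; rewrite -leqNgt.
  by rewrite negb_or -ltnNge negbK => /andP[].
- by case/orP: PD => [|]; [left|rewrite -ltNge; right].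
Qed.

Section Bounds.
Variables n delta D : nat.
Hypothesis n_gt0 : 0 < n.
Hypothesis delta_cube : n <= delta * delta * delta.
Hypothesis delta_min : forall i, i < delta -> i * i * i < n.

Definition initial_pot_bound : nat :=
  6 * (n * drop_weight n delta D (inf_value n delta)) + 2 * (delta * delta + n + n)
  + 4 * (inf_value n delta).+1.

Lemma delta_gt0 : 0 < delta.
Proof. by case: delta delta_cube n_gt0 => //=; lia. Qed.

Lemma cube_le : delta * delta * delta <= 8 * n.
Proof.
have := delta_gt0; have := delta_min; case: delta => // d min _.
by have := min d (ltnSn d); case: d {min} => [|d]; nia.
Qed.

Lemma infty_le : inf_value n delta <= 5 * n.
Proof.
rewrite /inf_value; have := cube_le; have := delta_gt0.
by case: delta => [|[|d]] //; nia.
Qed.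

(** Both [n] and [delta * delta] are at most the cube of [delta]. *)
Lemma infty_div_le : inf_value n delta %/ delta <= 2 * (delta * delta).
Proof.
rewrite -(leq_pmul2r delta_gt0); apply: leq_trans (leq_trunc_div _ _) _.
by rewrite /inf_value; have := delta_gt0; nia.
Qed.

Lemma initial_drop_weight_le :
  drop_weight n delta D (inf_value n delta) <= 30 * (n * (delta * delta)) + n * D.
Proof.
have h1 := infty_le; have h2 := infty_div_le.
have h3 : (inf_value n delta - 1) %/ delta <= 2 * (delta * delta).
  by apply: leq_trans h2; apply: leq_div2r; apply: leq_subr.
have k_gt0 : 0 < delta * delta by rewrite muln_gt0 delta_gt0.
rewrite /drop_weight.
have h4 : delta * delta * inf_value n delta <= delta * delta * (5 * n) by rewrite leq_mul2l h1 orbT.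
have h5 : n * minn (inf_value n delta) D.+1 <= n * D.+1 by rewrite leq_mul2l geq_minr orbT.
have h6 : (inf_value n delta).+1 * (inf_value n delta %/ delta + (inf_value n delta - 1) %/ delta)
    <= (6 * n) * (4 * (delta * delta)).
  by apply: leq_mul; [lia|]; apply: leq_trans (leq_add h2 h3) _; lia.
apply: leq_trans (leq_add (leq_add h4 h5) h6) _.
have : n <= n * (delta * delta) by apply: leq_pmulr.
by rewrite mulnS; move: (delta * delta) => k; nia.
Qed.

Lemma initial_pot_bound_le :
  initial_pot_bound <= 186 * (n * n * (delta * delta)) + 6 * (n * n * D) + 30 * n.
Proof.
rewrite /initial_pot_bound.
have h1 := infty_le; have h2 := initial_drop_weight_le.
have h3 : n * drop_weight n delta D (inf_value n delta) <=
    30 * (n * n * (delta * delta)) + n * n * D.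
  by apply: leq_trans (leq_mul (leqnn n) h2) _; rewrite mulnDr; lia.
have : delta * delta <= n * n * (delta * delta) by rewrite leq_pmull // muln_gt0 n_gt0.
by move: (n * drop_weight _ _ _ _) (n * n * (delta * delta)) h3; lia.
Qed.

Lemma total_time_le T :
  T <= 200 * initial_pot_bound + 20 * (delta + D) + 100 + 200 * (n * n) ->
  T <= 50 * 1000 * (n * n * (delta * delta) + n * n * D).
Proof.
have h := initial_pot_bound_le; have d0 := delta_gt0.
have h1 : n * n <= n * n * (delta * delta) by rewrite leq_pmulr // muln_gt0 d0.
have h2 : delta * delta <= n * n * (delta * delta) by rewrite leq_pmull // muln_gt0 n_gt0.
have h3 : D <= n * n * D by rewrite leq_pmull // muln_gt0 n_gt0.
have h4 : n <= n * n by rewrite leq_pmulr.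
have h5 : delta <= delta * delta by rewrite leq_pmulr.
move: initial_pot_bound h => u; move: (n * n * (delta * delta)) (n * n * D) h1 h2 h3 => a b.
by move: (delta * delta) (n * n) h4 h5 => k m; lia.
Qed.

Lemma word_size_enough w : D <= inf_value n delta -> n.+2 ^ 10 <= 2 ^ w ->
  initial_pot_bound + 10 * ((inf_value n delta + 2) * (n + 2)) < 2 ^ w.
Proof.
move=> leD; apply: leq_trans.
have h := initial_pot_bound_le; have hM := infty_le.
have k4 : delta * delta <= 4 * n.
  have := cube_le; have := delta_gt0; case: delta => [|[|d]] //; nia.
have h1 : n * n * (delta * delta) <= 4 * (n * n * n).
  by apply: leq_trans (leq_mul (leqnn (n * n)) k4) _; lia.
have h2 : n * n * D <= 5 * (n * n * n).
  by apply: leq_trans (leq_mul (leqnn (n * n)) (leq_trans leD hM)) _; lia.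
have h3 : n <= n * n * n by rewrite -mulnA leq_pmulr // muln_gt0 n_gt0.
have h4 : (inf_value n delta + 2) * (n + 2) <= 21 * (n * n * n).
  apply: (@leq_trans ((7 * n) * (3 * n))); first by apply: leq_mul; lia.
  by nia.
apply: (@leq_trans (2000 * (n * n * n))).
  by move: (n * n * (delta * delta)) (n * n * D) h h1 h2 h4; lia.
(* The exponent 10 splits: three factors cover the cube of [n], seven the constant 2000, as
   [3 ^ 7 = 2187] and [n + 2] is at least 3. *)
rewrite (expnD _ 3 7) mulnC; apply: leq_mul.
  by rewrite (expnS _ 2) -mulnn mulnA !leq_mul //; lia.
by apply: (@leq_trans (3 ^ 7)) => //; rewrite leq_exp2r.
Qed.

End Bounds.

(** * Real bounds on the running time *)

Local Open Scope ring_scope.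

(** The hypothesis at [D - 1] bounds all but one unit of [D] by [k]; the last unit contributes at
    most [1 <= k], thanks to the minimum with 1. *)
Lemma threshold_mul_le (R : realType) (eps : R) (D k : nat) : (0 < k)%N ->
  0 < eps -> (forall i, (i < D)%N -> i%:R * eps <= k%:R) ->
  D%:R * Num.min 1 eps <= 2 * k%:R.
Proof.
move=> k_gt0 eps_gt0; case: D => [|D] h; first by rewrite mul0r mulr_ge0.
have hD := h D (ltnSn D).
have k1 : 1 <= k%:R :> R by rewrite ler1n.
have m1 : Num.min 1 eps <= 1 by rewrite ge_min lexx.
have m2 : D%:R * Num.min 1 eps <= D%:R * eps.
  by rewrite ler_wpM2l // ge_min lexx orbT.
rewrite -natr1 mulrDl mul1r; lra.
Qed.

(** Cubing both sides turns the claim into the square of the hypothesis. *)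
Lemma square_le_powR (R : realType) (n delta : nat) :
  (delta * delta * delta <= 8 * n)%N ->
  (delta * delta)%:R <= 4 * n%:R `^ (2 / 3) :> R.
Proof.
move=> h; rewrite -(@ler_pXn2r _ 3) ?nnegrE ?mulr_ge0 ?powR_ge0 //.
rewrite exprMn -[X in _ <= _ * X]powR_mulrn ?powR_ge0 // -powRrM.
have -> : 2 / 3 * 3 = 2 :> R by lra.
rewrite powR_mulrn // -!natrX -natrM ler_nat.
have : ((delta * delta * delta) ^ 2 <= (8 * n) ^ 2)%N by rewrite leq_exp2r.
by rewrite !expnMn; move: (delta) => d; lia.
Qed.

Theorem theorem4 (R : realType) :
  exists (A : algorithm) (c : nat) (C : R),
  forall (n : nat) (E : {set 'I_n * 'I_n}) (s : 'I_n) (eps : R) (w : nat)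
         (us : seq ('I_n * 'I_n)),
    0 < eps ->
    (n.+2 ^ c <= 2 ^ w)%N ->
    valid_insertions E us ->
    exists (T : nat) (st : state),
      [/\ run A w eps E s us T st,
          (forall v : 'I_n,
             (dist R (insert_all E us) s v <= estimate R st v)%E /\
             (estimate R st v <=
                (1 + eps)%:E * dist R (insert_all E us) s v)%E)
        & T%:R <= C * (n%:R `^ (2 + 2 / 3) / Num.min 1 eps)].
Proof.
(* The exponent 10 is that of [word_size_enough]; 600 * 1000 is the factor 50 * 1000 of
   [total_time_le] times the 12 found at the end. *)
exists incremental_sssp, 10%N, (600 * 1000) => n E s eps w us eps_gt0 w_ge /andP[us_uniq _].
have n_gt0 : (0 < n)%N by apply: leq_ltn_trans (ltn_ord s).
have [delta [dcube dmin]] := least_cube_root n.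
have d_gt0 := delta_gt0 n_gt0 dcube.
have [D [D_le Dmin Dstop]] := least_exactness_threshold eps (inf_value n delta) (delta * delta).
have word_ok := word_size_enough n_gt0 dcube dmin D_le w_ge.
have [T [st [rT I f0 sp0 cost]]] :=
  run_incremental s d_gt0 D_le word_ok dcube (leqnn _) dmin Dmin Dstop E us.
exists T, st; split => //.
  by move=> v; apply: (estimate_correct d_gt0 D_le word_ok dcube) => //.
(* Insertions are distinct pairs, so their fixed overhead is at most quadratic in [n]. *)
have le_us : (size us <= n * n)%N.
  by rewrite -(card_uniqP us_uniq) -[X in (X * X)%N]card_ord -card_prod max_card.
have min_gt0 : 0 < Num.min 1 eps by rewrite lt_min ltr01.
have le_T := @total_time_le n delta D n_gt0 dcube dmin T.
have {}le_T : (T <= 50 * 1000 * (n * n * (delta * delta) + n * n * D))%N by apply: le_T; lia.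
rewrite mulrA ler_pdivlMr // powRD; last by rewrite pnatr_eq0 -lt0n n_gt0 implybT.
rewrite powR_mulrn //.
have k_le := @square_le_powR R n delta (cube_le n_gt0 dcube dmin).
have k_gt0 : (0 < delta * delta)%N by rewrite muln_gt0 d_gt0.
have Dm_le := threshold_mul_le k_gt0 eps_gt0 (fun i h => (Dmin i h).2).
have m_le1 : Num.min 1 eps <= 1 by rewrite ge_min lexx.
move: le_T; rewrite -(ler_nat R) natrM natrD [(n * n * D)%:R]natrM [(n * n * _)%:R]natrM.
rewrite [(n * n)%:R]natrM -expr2 -mulrDr => le_T.
apply: le_trans (ler_wpM2r (ltW min_gt0) le_T) _; rewrite [(50 * 1000)%:R]natrM.
have n2 : 0 <= n%:R ^+ 2 :> R by apply: exprn_ge0.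
have k0 : 0 <= (delta * delta)%:R :> R by [].
move: (Num.min 1 eps) (n%:R ^+ 2) ((delta * delta)%:R) (D%:R : R) (n%:R `^ _)
  min_gt0 n2 k0 Dm_le m_le1 k_le => m N k d P m0 N0 k0 dm m1 kP.
have km : k * m <= k by rewrite ler_piMr.
have -> : 50 * 1000 * (N * (k + d)) * m = 50 * 1000 * (N * (k * m + d * m)) by ring.
have -> : 600 * 1000 * (N * P) = 50 * 1000 * (N * (12 * P)) by ring.
(* Here 12 is 4 + 8: [k * m <= k <= 4 * P] uses [m <= 1], and [d * m <= 2 * k <= 8 * P]. Only the
   part with [d] grows with the inverse of [eps]. *)
have le_kd : k * m + d * m <= 12 * P by clear -km dm kP; lra.
by rewrite ler_wpM2l ?ler_wpM2l ?mulr_ge0 ?ler0n.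
Qed.
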